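(* Let $L\in(0,\infty]$ and let $\|\cdot\|_{X(0,L)}$ be a rearrangement-invariant function norm on $(0,L)$. Let $u,v\colon(0,L)\to(0,\infty)$ be nonincreasing; if $L<\infty$, assume that $v(L^-)>0$. Let $\nu\colon(0,L)\to(0,L)$ be an increasing bijection; if $L=\infty$, assume that $\nu\in\underline{D}^{\infty}$. Set $$\varrho(f)=\sup_{h\sim f}\Big\|u(t)\int_{\nu(t)}^L h(s)v(s)\,ds\Big\|_{X(0,L)},\quad f\in\mathfrak{M}^+(0,L),$$ where the supremum extends over all $h\in\mathfrak{M}^+(0,L)$ equimeasurable with $f$. The functional $\varrho$ is a rearrangement-invariant function norm if and only if the following condition (A) holds: (A) if $L<\infty$: the function $t\mapsto u(t)\int_{\nu(t)}^Lv(s)\,ds$ belongs to $X(0,L)$; if $L=\infty$: the function $t\mapsto u(t)\chi_{(0,\nu^{-1}(1))}(t)\int_{\nu(t)}^1v(s)\,ds$ belongs to $X(0,\infty)$ and $\limsup_{\tau\to\infty}v(\tau)\|u\chi_{(0,\nu^{-1}(\tau))}\|_{X(0,\infty)}<\infty$. If (A) is satisfied, then the rearrangement-invariant function space induced by $\varrho$ is the optimal domain space for the operator $H_{u,v,\nu}$ and $X(0,L)$. If (A) is not satisfied, then there is no rearrangement-invariant function space $Z(0,L)$ such that $H_{u,v,\nu}\colon Z(0,L)\to X(0,L)$ is bounded.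
   Context: Conventions: $\frac1\infty=0\cdot\infty=0$. $\mathfrak{M}(0,L)$ is the set of (Lebesgue) measurable functions on $(0,L)$ with values in $[-\infty,\infty]$, and $\mathfrak{M}^+(0,L)$ is the subset of those that are nonnegative a.e. Functions $f,g$ are equimeasurable, $f\sim g$, if $|\{|f|>\lambda\}|=|\{|g|>\lambda\}|$ for every $\lambda\in(0,\infty)$. A rearrangement-invariant function norm on $(0,L)$ is a functional $\|\cdot\|_{X(0,L)}\colon\mathfrak{M}^+(0,L)\to[0,\infty]$ such that, for all $f,g,f_k\in\mathfrak M^+(0,L)$ and $\lambda\in[0,\infty)$: (P1) $\|f\|=0$ iff $f=0$ a.e., $\|\lambda f\|=\lambda\|f\|$, $\|f+g\|\le\|f\|+\|g\|$; (P2) $f\le g$ a.e. implies $\|f\|\le\|g\|$; (P3) $f_k\nearrow f$ a.e. implies $\|f_k\|\nearrow\|f\|$; (P4) $\|\chi_E\|<\infty$ for every measurable $E$ of finite measure; (P5) for every measurable $E$ of finite measure there is a finite constant $C_E>0$ with $\int_E f\le C_E\|f\|$ for all $f$; (P6) $\|f\|=\|g\|$ whenever $f\sim g$. It is extended to $\mathfrak M(0,L)$ by $\|f\|=\|\,|f|\,\|$, and $X(0,L)=\{f\in\mathfrak M(0,L):\|f\|_{X(0,L)}<\infty\}$ is the induced rearrangement-invariant function space. $X(0,L)\hookrightarrow Y(0,L)$ means that there is $C>0$ with $\|f\|_{Y(0,L)}\le C\|f\|_{X(0,L)}$ for all $f\in\mathfrak M(0,L)$. $v(L^-)$ is the left limit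 at $L$. $\nu\in\underline{D}^\infty$ means that there is $\theta>1$ with $\liminf_{t\to\infty}\frac{\nu(\theta t)}{\nu(t)}>1$. The operator is $H_{u,v,\nu}g(t)=u(t)\int_{\nu(t)}^L|g(s)|v(s)\,ds$, $t\in(0,L)$, $g\in\mathfrak M(0,L)$. An operator $T$ is bounded from $X(0,L)$ to $Y(0,L)$ if $\|Tf\|_{Y(0,L)}\le C\|f\|_{X(0,L)}$ for some $C$ and all $f$. A rearrangement-invariant function space $W(0,L)$ is the optimal domain space for $T$ and $X(0,L)$ if $T\colon W(0,L)\to X(0,L)$ is bounded and $Z(0,L)\hookrightarrow W(0,L)$ whenever $Z(0,L)$ is a rearrangement-invariant function space such that $T\colon Z(0,L)\to X(0,L)$ is bounded. *)

(* Defs.v *)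
From HB Require Import structures.
From mathcomp Require Import all_boot all_order all_algebra.
From mathcomp Require Import all_classical all_reals all_analysis measurable_realfun.
Set Implicit Arguments.
Unset Strict Implicit.
Unset Printing Implicit Defensive.
Import Order.TTheory GRing.Theory Num.Theory.
Import numFieldNormedType.Exports.

Local Open Scope classical_set_scope.
Local Open Scope ring_scope.
Local Open Scope ereal_scope.

(* The canonical measurable structure on R in the library is the Borel one.
   [lebR R] is the same carrier with the sigma-algebra of Lebesgue (that is,
   Caratheodory) measurable sets, on which the completed Lebesgue measure
   lives. *)
Definition lebR (R : realType) : measurableType _ :=
  caratheodory_type ((wlength (@idfun R))^*%mu).

Definition leb (R : realType) : {measure set (lebR R) -> \bar R} :=
  @completed_lebesgue_measure R.

Section RearrangementInvariant.
Context {R : realType}.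
Implicit Types (L : \bar R) (f g : R -> \bar R) (N X Y W Z : (R -> \bar R) -> \bar R).

(* Open interval of real numbers with extended real endpoints. *)
Definition itv_oo (a b : \bar R) : set R := [set t : R | a < t%:E < b].

(* A function on (0, L) is represented by a function on R whose values outside
   (0, L) are immaterial. *)
Definition dom L : set R := itv_oo 0 L.

Definition Mfun L f : Prop :=
  @measurable_fun _ _ (lebR R) _ (dom L) f.

Definition Mplus L f : Prop :=
  Mfun L f /\ {ae leb R, forall t : lebR R, dom L t -> 0 <= f t}.

Definition equimeasurable L f g : Prop :=
  forall lam : R, (0 < lam)%R ->
    leb R [set t | dom L t /\ lam%:E < `|f t|] =
    leb R [set t | dom L t /\ lam%:E < `|g t|].

(* N is a total function on R -> \bar R, but only its values on Mplus L matter: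
   by rin_mono they depend only on the a.e. class of the restriction to (0, L). *)
Record is_ri_norm L N : Prop := IsRiNorm {
  rin_ge0 : forall f, Mplus L f -> 0 <= N f;
  rin_eq0 : forall f, Mplus L f ->
    (N f = 0 <-> {ae leb R, forall t : lebR R, dom L t -> f t = 0});
  rin_homo : forall f (lam : R), Mplus L f -> (0 <= lam)%R ->
    N (fun t => lam%:E * f t) = lam%:E * N f;
  rin_triangle : forall f g, Mplus L f -> Mplus L g ->
    N (fun t => f t + g t) <= N f + N g;
  rin_mono : forall f g, Mplus L f -> Mplus L g ->
    {ae leb R, forall t : lebR R, dom L t -> f t <= g t} -> N f <= N g;
  rin_cvg : forall (f_ : nat -> R -> \bar R) f,
    (forall k, Mplus L (f_ k)) -> Mplus L f ->
    {ae leb R, forall t : lebR R, dom L t ->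
      nondecreasing_seq (f_ ^~ t) /\ f_ ^~ t @ \oo --> f t} ->
    nondecreasing_seq (fun k => N (f_ k)) /\ N (f_ k) @[k --> \oo] --> N f;
  rin_fin : forall E : set R, @measurable _ (lebR R) E -> E `<=` dom L ->
    leb R E < +oo -> N (fun t => (\1_E t)%:E) < +oo;
  rin_loc : forall E : set R, @measurable _ (lebR R) E -> E `<=` dom L ->
    leb R E < +oo ->
    exists2 C : R, (0 < C)%R & forall f, Mplus L f ->
      \int[leb R]_(t in E) f t <= C%:E * N f;
  rin_equi : forall f g, Mplus L f -> Mplus L g -> equimeasurable L f g ->
    N f = N g
}.

(* A rearrangement-invariant function space is given by a norm N with
   [is_ri_norm L N]: it consists of the f with [in_space L N f], normed by
   [ext_norm N]. *)
Definition ext_norm N f : \bar R := N (fun t => `|f t|).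

Definition in_space L N f : Prop := Mfun L f /\ ext_norm N f < +oo.

Definition embeds L X Y : Prop :=
  exists2 C : R, (0 < C)%R &
    forall f, Mfun L f -> ext_norm Y f <= C%:E * ext_norm X f.

Definition bounded_op L (T : (R -> \bar R) -> R -> \bar R) X Y : Prop :=
  exists C : R, forall f, Mfun L f -> ext_norm Y (T f) <= C%:E * ext_norm X f.

Definition optimal_domain L (T : (R -> \bar R) -> R -> \bar R) X W : Prop :=
  [/\ is_ri_norm L W, bounded_op L T W X &
      forall Z, is_ri_norm L Z -> bounded_op L T Z X -> embeds L Z W].

Section Operator.
Variables (L : \bar R) (u v nu : R -> R).

Definition H_op (g : R -> \bar R) (t : R) : \bar R :=
  (u t)%:E *
  \int[leb R]_(s in itv_oo (nu t)%:E L)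
    (`|g s| * (v s)%:E).

Definition varrho X (f : R -> \bar R) : \bar R :=
  ereal_sup
    [set X (fun t => (u t)%:E *
         \int[leb R]_(s in itv_oo (nu t)%:E L)
           (h s * (v s)%:E))
    | h in [set h | Mplus L h /\ equimeasurable L h f]].

Definition nu_inv : R -> R := pinv (dom L) nu.

Definition condA_fin X : Prop :=
  in_space L X (fun t => (u t)%:E *
    \int[leb R]_(s in itv_oo (nu t)%:E L) (v s)%:E).

Definition condA_inf X : Prop :=
  in_space L X (fun t => (u t)%:E * (\1_(itv_oo 0 (nu_inv 1)%:E) t)%:E *
    \int[leb R]_(s in itv_oo (nu t)%:E 1) (v s)%:E)
  /\ limf_esup (fun tau : R => (v tau)%:E *
       ext_norm X (fun t => (u t * \1_(itv_oo 0 (nu_inv tau)%:E) t)%:E))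
       +oo%R < +oo.

Definition condA X : Prop :=
  (L < +oo -> condA_fin X) /\ (L = +oo -> condA_inf X).

End Operator.

Definition underD_infty (nu : R -> R) : Prop :=
  exists2 theta : R, (1 < theta)%R &
    1 < limf_einf (fun t : R => (nu (theta * t) / nu t)%:E) +oo%R.

End RearrangementInvariant.

(* Main.v *)
(* Call [rho] the functional [varrho L u v nu X]. It is the supremum of [N h := X (kern h)]
   over the rearrangements [h] of [f], where [N] is monotone, subadditive and continuous
   along increasing sequences. Suppose that [h] takes finitely many values and has support
   of finite measure. Ranking the points of [(0, L)] by the value of [h] (ties broken by
   position) gives a measure preserving map [sigma] of [(0, L)] onto itself; composing
   decreasing rearrangements with [sigma] shows that [h] is dominated by a rearrangement
   of [f] as soon as its distribution function is dominated by that of [f]. This yields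
   monotonicity and the Fatou property of [rho]. The triangle inequality is proved for
   dyadic-valued [f] and [g] by rearranging the pair [(f, g)], sorted by [f + g], along
   [sigma], and then passes to the limit.

   For [L = +oo], [nu_D] and the rearrangement invariance of [X] bound the norm of
   [u] on [(0, nu^-1 (tau + 1))] by a multiple of its norm on [(0, nu^-1 tau)], so that
   cutting a set of finite measure along the integers bounds [rho] on its indicator.
   Conversely, a bounded operator is tested on the indicators of [(0, L)] or, for
   [L = +oo], of [(0, 1)] and of the intervals [(tau - 1, tau)]. *)

Require Import Defs.
From HB Require Import structures.
From mathcomp Require Import all_boot all_order all_algebra.
From mathcomp Require Import all_classical all_reals all_analysis measurable_realfun.
From mathcomp Require Import lra zify.
Import Order.TTheory GRing.Theory Num.Theory.
Import numFieldNormedType.Exports.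
Import HBSimple HBNNSimple.
Set Implicit Arguments.
Unset Strict Implicit.
Unset Printing Implicit Defensive.

Local Open Scope classical_set_scope.
Local Open Scope ring_scope.
Local Open Scope ereal_scope.

(** The restriction to finitely many values and support of finite measure is forced by [L = +oo]:
    once a superlevel set has infinite measure, the points of smaller value receive no finite rank,
    and a function need not be its decreasing rearrangement composed with a measure preserving map.
    Each dyadic approximation of [h] therefore has its own rank [sigma], and no single majorant of
    [h] itself is produced. What survives the limit is a bound, which is why the comparison lemmas
    speak of a constant [c] dominating the functional on all rearrangements. In the triangle
    inequality [f] and [g] cannot be rearranged separately: a rearrangement of the sum splits only
    if the joint law of the pair is kept. On the half-line, the indicator of an interval of length 1
    ending at [tau] has a kernel between [v(tau) u] cut at [nu^-1 (tau - 1)] and [v(tau - 1) u] cut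
    at [nu^-1 tau]. The limsup in (A) pairs [v(tau)] with [nu^-1 tau], so both directions lose a
    unit shift, which the growth of [nu] repairs. *)

Lemma ge0_ereal_between (R : realType) (x y : \bar R) : 0 <= x -> x < y ->
  exists r : R, x < r%:E < y.
Proof.
case: x => [x| |]//; case: y => [y| |]//; rewrite ?lte_fin => _ xy.
  by exists ((x + y) / 2)%R; rewrite !lte_fin; apply/andP; split; lra.
by exists (x + 1)%R; rewrite lte_fin ltrDl ltr01 ltry.
Qed.

(** * Lebesgue measure on the line *)

Section LebesgueBasics.
Context {R : realType}.
Local Notation mble := (@measurable _ (lebR R)).
Local Notation mu := (leb R).

Lemma lebesgue_mble (A : set R) : measurable A -> mble A.
Proof. by move=> mA; exact: sub_caratheodory. Qed.

Lemma interval_mble (A : set R) : is_interval A -> mble A.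
Proof. by move=> iA; apply: lebesgue_mble; exact: is_interval_measurable. Qed.

Lemma leb_itv (i : interval R) : mu [set` i] = lebesgue_measure [set` i].
Proof. by []. Qed.

Lemma itv_oo_mble (a b : \bar R) : mble (itv_oo a b).
Proof.
apply: interval_mble => x y /andP[ax xb] /andP[ay yb] z /andP[xz zy].
apply/andP; split; first by rewrite (lt_le_trans ax)// lee_fin.
by rewrite (le_lt_trans _ yb)// lee_fin.
Qed.

Lemma leb_itv_oo (a b : R) : (a <= b)%R -> mu (itv_oo a%:E b%:E) = (b - a)%:E.
Proof.
move=> ab; have -> : itv_oo a%:E b%:E = [set` `]a, b[] :> set R.
  by apply/seteqP; split=> t; rewrite /itv_oo/= in_itv/= !lte_fin.
rewrite leb_itv lebesgue_measure_itv/= lte_fin.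
by case: ltP => // ba; rewrite (@le_anti _ _ a b) ?ab// subrr.
Qed.

Lemma le_leb (A B : set R) : mble A -> mble B -> A `<=` B -> mu A <= mu B.
Proof. by move=> mA mB; apply: (@le_measure _ _ _ (leb R)); rewrite inE. Qed.

Lemma lebU (A B : set R) : mble A -> mble B -> A `&` B = set0 ->
  mu (A `|` B) = mu A + mu B.
Proof. by move=> mA mB AB; rewrite measureU. Qed.

Lemma lebD (A B : set R) : mble A -> mble B -> mu A < +oo -> B `<=` A ->
  mu (A `\` B) = mu A - mu B.
Proof. by move=> mA mB Aoo /setIidPr AB; rewrite measureD// AB. Qed.

Lemma leb_bigcup_cvg (F : nat -> set R) : (forall n, mble (F n)) ->
  (forall n m, (n <= m)%N -> F n `<=` F m) ->
  mu (F n) @[n --> \oo] --> mu (\bigcup_n F n).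
Proof.
move=> mF ndF; apply: (@nondecreasing_cvg_mu _ _ _ (leb R)) => //.
  exact: bigcupT_measurable.
by move=> n m nm; apply/subsetPset; exact: ndF.
Qed.

Lemma leb_bigcup_le (F : nat -> set R) (c : \bar R) : (forall n, mble (F n)) ->
  (forall n m, (n <= m)%N -> F n `<=` F m) ->
  (forall n, mu (F n) <= c) -> mu (\bigcup_n F n) <= c.
Proof.
move=> mF ndF Fc; have cF := leb_bigcup_cvg mF ndF.
rewrite -(cvg_lim _ cF)//; apply: lime_le; last exact: nearW.
by apply/cvg_ex; exists (mu (\bigcup_n F n)).
Qed.

(** * Parametrizing a set by its mass to the left of a point *)

Definition mass (B : set R) (t : R) : \bar R := mu (B `&` itv_oo 0 t%:E).

Section Cut.
Variable B : set R.
Hypotheses (mB : mble B) (B_gt0 : forall t, B t -> (0 < t)%R).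

Lemma mass_mble (t : R) : mble (B `&` itv_oo 0 t%:E).
Proof. by apply: measurableI => //; exact: itv_oo_mble. Qed.
Hint Resolve mass_mble : core.

Lemma le_mass (s t : R) : (s <= t)%R -> mass B s <= mass B t.
Proof.
move=> st; apply: le_leb => // x [Bx /andP[x0 xs]]; split=> //.
by apply/andP; split=> //; rewrite (lt_le_trans xs)// lee_fin.
Qed.

Lemma mass_le (t : R) : (0 <= t)%R -> mass B t <= t%:E.
Proof.
move=> t0; rewrite -[leRHS]sube0 -EFinB -leb_itv_oo//.
by apply: le_leb; [exact: mass_mble|exact: itv_oo_mble|move=> x []].
Qed.

Lemma massD (t e : R) : (0 < t)%R -> (0 < e)%R -> mass B (t + e) <= mass B t + e%:E.
Proof.
move=> t0 e0; have mI : mble [set` `[t, (t + e)%R[].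
  by apply: lebesgue_mble; exact: measurable_itv.
have -> : e%:E = mu [set` `[t, (t + e)%R[].
  rewrite leb_itv lebesgue_measure_itv/= lte_fin ltrDl e0.
  by rewrite -EFinB addrAC subrr add0r.
apply: (@le_trans _ _ (mu ((B `&` itv_oo 0 t%:E) `|` [set` `[t, (t + e)%R[]))); last first.
  by apply: measureU2 => //; exact: mass_mble.
apply: le_leb; [exact: mass_mble|by apply: measurableU => //; exact: mass_mble|].
move=> x [Bx /andP[x0 xe]]; have [xt|tx] := ltP x t.
  by left; split=> //; apply/andP; split=> //; rewrite lte_fin.
by right; rewrite /= in_itv/= tx -lte_fin.
Qed.

Lemma mass_lt_mble (b : \bar R) : mble [set t | B t /\ mass B t < b].
Proof.
have -> : [set t | B t /\ mass B t < b] = B `&` [set t | mass B t < b] by [].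
apply: measurableI => //; apply: interval_mble => x y /= xb yb z /andP[xz zy].
by apply: le_lt_trans yb; exact: le_mass.
Qed.

Let leb_mass_lt_aux (r : R) : (0 < r)%R -> r%:E < mu B ->
  mu [set t | B t /\ mass B t < r%:E] = r%:E.
Proof.
move=> r0 rB; pose J := [set t : R | (0 < t)%R /\ mass B t < r%:E].
have Jr : J (r / 2)%R.
  split; first by rewrite divr_gt0.
  apply: (le_lt_trans (mass_le _)); first by rewrite divr_ge0// ltW.
  by rewrite lte_fin gtr_pMr// invf_lt1// ltr1n.
have [n rn] : exists n, r%:E < mass B n%:R.
  apply: contrapT => /forallNP nr.
  have : mu (\bigcup_n (B `&` itv_oo 0 n%:R%:E)) <= r%:E.
    apply: leb_bigcup_le => [k|k l kl|k]; first exact: mass_mble.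
      move=> x [Bx /andP[x0 xk]]; split=> //.
      by apply/andP; split=> //; rewrite (lt_le_trans xk)// lee_fin ler_nat.
    by rewrite leNgt; apply/negP/nr.
  apply/negP; rewrite -ltNge; apply: lt_le_trans rB _; apply: le_leb => //.
    by apply: bigcupT_measurable => k.
  move=> x Bx; exists (Num.truncn x).+1 => //; split=> //; apply/andP; split.
    by rewrite lte_fin B_gt0.
  by rewrite lte_fin truncnS_gt.
have Jub : ubound J n%:R.
  move=> t [t0 tr]; rewrite leNgt; apply/negP => nt.
  by have := lt_trans rn (le_lt_trans (le_mass (ltW nt)) tr); rewrite ltxx.
have hsJ : has_sup J by split; [exists (r / 2)%R|exists n%:R].
(* By [massD] the mass is continuous, so it equals [r] at the supremum [t0] of [J], and the set in
   question is [B] cut at [t0]. *)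
set t0 := sup J; have t0_gt0 : (0 < t0)%R.
  by apply: (@lt_le_trans _ _ (r / 2)%R); [rewrite divr_gt0|exact: ub_le_sup hsJ.2 _ _].
have lt_t0 t : (t < t0)%R -> mass B t < r%:E.
  move=> /(sup_gt hsJ.1)[s [s0 sr] ts]; apply: le_lt_trans sr.
  by apply: le_mass; exact: ltW.
have gt_t0 t : (t0 < t)%R -> r%:E <= mass B t.
  move=> tt; rewrite leNgt; apply/negP => tr.
  suff : (t <= t0)%R by rewrite leNgt tt.
  by apply: ub_le_sup hsJ.2 _ _; split=> //; exact: lt_trans tt.
have mass_t0 : mass B t0 = r%:E.
  apply/eqP; rewrite eq_le; apply/andP; split; apply/lee_addgt0Pr; move=> /= e e0; 
    pose d : R := Num.min ((e : R) / 2)%R (t0 / 2)%R.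
    have d0 : (0 < d)%R by rewrite lt_min !divr_gt0.
    have dt : (0 < t0 - d)%R.
      have : (d <= t0 / 2)%R by rewrite ge_min lexx orbT.
      lra.
    have := massD dt d0; rewrite subrK => /le_trans; apply.
    apply: leeD; first by rewrite ltW// lt_t0// ltrBlDr ltrDl.
    rewrite lee_fin; have : (d <= e / 2)%R by rewrite ge_min lexx.
    lra.
  by apply: le_trans (massD t0_gt0 e0); apply: gt_t0; rewrite ltrDl.
rewrite -[RHS]mass_t0; congr (mu _); apply/seteqP; split=> t.
  move=> [Bt tr]; split=> //; apply/andP; rewrite !lte_fin B_gt0//; split=> //.
  rewrite ltNge; apply/negP => /le_mass; rewrite mass_t0.
  by rewrite leNgt tr.
by move=> [Bt /andP[_]]; rewrite lte_fin => /lt_t0.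
Qed.

(* Nonatomicity: the parameter [mass B] pushes [mu] on [B] to Lebesgue measure on
   [(0, mu B)]. *)
Lemma leb_mass_lt (b : \bar R) : 0 <= b ->
  mu [set t | B t /\ mass B t < b] = mine b (mu B).
Proof.
move=> b0; have [bB|Bb] := ltP b (mu B).
  move: b b0 bB => [r| |]; rewrite ?lee_fin ?leNye//; last first.
    by move=> _; rewrite ltNge leey.
  rewrite le_eqVlt => /predU1P[<- _|r0 rB]; last exact: leb_mass_lt_aux.
  rewrite -[RHS](measure0 mu); congr (mu _).
  by apply/seteqP; split=> // t [_]; rewrite ltNge measure_ge0.
have le1 : mu [set t | B t /\ mass B t < b] <= mu B.
  by apply: le_leb => //; [exact: mass_lt_mble|move=> t []].
apply/eqP; rewrite eq_le le1/=; rewrite leNgt; apply/negP => lt1.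
have fin1 : mu [set t | B t /\ mass B t < b] \is a fin_num.
  by rewrite ge0_fin_numE ?measure_ge0//; exact: lt_le_trans lt1 (leey _).
(* If the measure stayed below [mu B], take a real [x] in between: by the previous case the sublevel
   set at [x] has measure [x], yet it lies in the one at [b]. *)
have [x x1 x2] : exists2 x : R, mu [set t | B t /\ mass B t < b] < x%:E & x%:E < mu B.
  have [x] := ge0_ereal_between (measure_ge0 _ _) lt1.
  by case/andP => ? ?; exists x.
have x0 : (0 < x)%R by rewrite -lte_fin (le_lt_trans _ x1).
have := leb_mass_lt_aux x0 x2; apply/eqP; rewrite lt_eqF//.
apply: le_lt_trans x1; apply: le_leb; [exact: mass_lt_mble|exact: mass_lt_mble|].
by move=> t [Bt tx]; split=> //; apply: lt_le_trans tx (le_trans (ltW x2) Bb).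
Qed.

End Cut.
End LebesgueBasics.

(** Here [g] will be the measure of a superlevel set and [e], possibly infinite, that of the fiber
    ranked right after it. *)
Lemma mine_split (R : realDomainType) (a e g : \bar R) : 0 <= e ->
  g \is a fin_num -> g <= a -> mine (a - g) e + g = mine a (e + g).
Proof.
move=> e0; case: g => // g _ ga; move: e0 ga.
case: e => [e| |]//; case: a => [r| |]// e0 ga; rewrite ?addye//.
- rewrite -EFinB -!EFinD -!EFin_min -EFinD; congr (_%:E); rewrite /Num.min.
  by move: e0 ga; rewrite !lee_fin => ? ?; case: ltP => ?; case: ltP => ?; lra.
- by rewrite -EFinB !miney -EFinD subrK.
Qed.

(** * Ranks and rearrangements *)

Section Rearrangement.
Context {R : realType}.
Local Notation mble := (@measurable _ (lebR R)).
Local Notation mu := (leb R).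
Variable L : \bar R.
Local Notation D := (dom L).

(** Unlike in [Mplus], nonnegativity holds at every point of the domain, so monotone convergence and
    dyadic approximation apply without exceptional sets. The null sets are removed in [varrho_le]
    and [varrho_cvg]. *)
Definition pos (f : R -> \bar R) : Prop :=
  Mfun L f /\ forall t, D t -> 0 <= f t.

Definition dist (f : R -> \bar R) (lam : R) : \bar R :=
  mu [set t | D t /\ lam%:E < f t].

Lemma dom_mble : mble D.
Proof. exact: itv_oo_mble. Qed.
Hint Resolve dom_mble : core.

Lemma dom_gt0 t : D t -> (0 < t)%R.
Proof. by move=> /andP[]; rewrite lte_fin. Qed.

Lemma Mfun_gt f (y : \bar R) : Mfun L f -> mble [set t | D t /\ y < f t].
Proof. by move=> mf; exact: emeasurable_fun_o_infty. Qed.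

Lemma MfunP f : (forall y : R, mble [set t | D t /\ y%:E < f t]) -> Mfun L f.
Proof.
move=> h; apply: (measurability _ (ErealGenOInfty.measurableE R)) => //.
move=> _ [_ [y ->] <-]; have := h y; congr (mble _).
by apply/seteqP; split=> t /= [Dt]; rewrite in_itv/= ?andbT => ?; split.
Qed.

Definition level (m : R -> nat) (k : nat) : set R :=
  [set t | D t /\ (k < m t)%N].

(** Simple functions are stored as integer numerators over a power of two. The finite support makes
    every level measure a real number, so that it can be subtracted. *)
Record step (m : R -> nat) : Prop := Step {
  step_mble : forall k, mble (level m k);
  step_fin : mu (level m 0) < +oo;
  step_bounded : exists M, forall t, (m t <= M)%N }.

(** Measure preservation tested on sublevel sets: [sigma] carries Lebesgue measure on the domain to
    Lebesgue measure on [(0, S)]. *)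
Record ranked (sigma : R -> \bar R) (S : \bar R) : Prop := Ranked {
  ranked_mble : forall a, mble [set t | D t /\ sigma t < a];
  ranked_ge0 : forall t, 0 <= sigma t;
  ranked_leb : forall a, 0 <= a ->
    mu [set t | D t /\ sigma t < a] = mine a S }.

Lemma le_level m k l : (k <= l)%N -> level m l `<=` level m k.
Proof. by move=> kl t [Dt lt]; split=> //; exact: leq_ltn_trans lt. Qed.

(** * The rank of a simple function *)

Section Rank.
Variables (m : R -> nat) (sm : step m).
Let E k := [set t | D t /\ m t = k].
Let sigma (t : R) : \bar R := mu (level m (m t)) + mass (E (m t)) t.

Let geq_mble k : mble [set t | D t /\ (k <= m t)%N].
Proof.
case: k => [|k]; last exact: (step_mble sm k).
by rewrite (_ : [set _ | _] = D)//; apply/seteqP; split=> [t []|t Dt].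
Qed.

Let E_mble k : mble (E k).
Proof.
rewrite (_ : E k = [set t | D t /\ (k <= m t)%N] `\` level m k).
  by apply: measurableD; [exact: geq_mble|exact: step_mble].
apply/seteqP; split=> t.
  by move=> [Dt mt]; split; [rewrite /= mt|move=> [_]; rewrite mt ltnn].
move=> [[Dt kt] nlt]; split=> //; apply/eqP; rewrite eqn_leq kt andbT leqNgt.
by apply/negP => lt; apply: nlt.
Qed.

Let E_gt0 k t : E k t -> (0 < t)%R.
Proof. by case=> /dom_gt0. Qed.

Let level_fin k : mu (level m k) \is a fin_num.
Proof.
rewrite ge0_fin_numE//; apply: le_lt_trans (step_fin sm).
by apply: le_leb; [exact: step_mble..|exact: le_level].
Qed.

Let geqE k : [set t | D t /\ (k <= m t)%N] = E k `|` level m k.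
Proof.
apply/seteqP; split=> t.
  move=> [Dt]; rewrite leq_eqVlt => /predU1P[kt|kt]; [by left|by right].
by case=> [[Dt <-]//|[Dt kt]]; split=> //; exact: ltnW.
Qed.

Let E_level k : E k `&` level m k = set0.
Proof. by apply/seteqP; split=> // t [[_ <-] [_]]; rewrite ltnn. Qed.

Let E_sigma k (a : \bar R) : [set t | E k t /\ sigma t < a] =
  [set t | E k t /\ mass (E k) t < a - mu (level m k)].
Proof.
by apply/seteqP; split=> t /= [[Dt mt]]; rewrite /sigma mt => ta; split=> //;
  move: ta; rewrite lteBrDl ?level_fin.
Qed.

Let E_sigma_mble k a : mble [set t | E k t /\ sigma t < a].
Proof. by rewrite E_sigma; exact: mass_lt_mble. Qed.

Let sigma_mble a : mble [set t | D t /\ sigma t < a].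
Proof.
rewrite (_ : [set _ | _] = \bigcup_k [set t | E k t /\ sigma t < a]).
  exact: bigcupT_measurable.
by apply/seteqP; split=> t; [move=> [Dt ta]; exists (m t)|move=> [k _ [[]]]].
Qed.

(** Descending induction on [k] from beyond the bound [M], where both sets are empty; the fiber
    [E k] is ranked after [level m k]. Only [E 0], which comes last, can have infinite measure. *)
Let leb_geq_sigma k (a : \bar R) : 0 <= a ->
  mu [set t | [set t | D t /\ (k <= m t)%N] t /\ sigma t < a] =
  mine a (mu [set t | D t /\ (k <= m t)%N]).
Proof.
move=> a0; have [M mM] := step_bounded sm.
have [n] := ubnP (M.+1 - k); elim: n k => // n IH k kn.
have [Mk|kM] := ltnP M k.
  have e0 : [set t | D t /\ (k <= m t)%N] = set0.
    by apply/seteqP; split=> // t [_ /leq_trans/(_ (mM t))]; rewrite leqNgt Mk.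
  rewrite e0 measure0 (_ : [set _ | _] = set0) ?measure0; last first.
    by apply/seteqP; split=> // t [].
  by rewrite /mine ltNge a0.
have {}IH := IH k.+1; rewrite -/(level m k) in IH.
rewrite geqE lebU//; last exact: step_mble.
rewrite (_ : [set t | (E k `|` level m k) t /\ sigma t < a] =
  [set t | E k t /\ sigma t < a] `|` [set t | level m k t /\ sigma t < a]); last first.
  by apply/seteqP; split=> t; [case=> -[]; [left|right]|case=> -[]; split=> //; [left|right]].
rewrite lebU//; last 2 first.
- rewrite (_ : [set t | _ /\ _] = level m k `&` [set t | D t /\ sigma t < a]).
    by apply: measurableI => //; exact: step_mble.
  by apply/seteqP; split=> [t [[Dt lt] ?]|t [? [? ?]]].
- apply/seteqP; split=> // t [[Et _] [lt _]].
  by have : (E k `&` level m k) t by []; rewrite E_level.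
rewrite IH; last by lia.
rewrite E_sigma; have [ga|ag] := leP (mu (level m k)) a.
  rewrite (leb_mass_lt (@E_mble k) (@E_gt0 k)); last by rewrite sube_ge0 ?level_fin.
  exact: mine_split.
rewrite (_ : [set _ | _] = set0) ?measure0 ?add0e; last first.
  apply/seteqP; split=> // t [_]; rewrite ltNge => /negP; apply.
  apply: le_trans (measure_ge0 _ _); by rewrite leeBlDr ?level_fin// add0e ltW.
by rewrite min_l// (le_trans (ltW ag))// leeDr.
Qed.

Let sigma_ranked : ranked sigma (mu D).
Proof.
split=> [//|t|a a0]; first by rewrite adde_ge0.
have := leb_geq_sigma 0 a0.
by rewrite (_ : [set t | D t /\ (0 <= m t)%N] = D)//; apply/seteqP; split=> [t []|t Dt].
Qed.

(** The strict inequality can fail only at points with no mass of their own fiber to the right. By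
    [leb_mass_lt] these form a null set on each fiber, and there are countably many fibers. *)
Lemma rank_exists : exists2 sigma, ranked sigma (mu D) &
  {ae mu, forall t : lebR R, D t -> forall k, (k < m t)%N ->
     sigma t < mu (level m k)}.
Proof.
exists sigma => //.
have EkS k : E k.+1 `<=` level m 0 by move=> t [Dt mt]; split=> //; rewrite mt.
have E_fin k : mu (E k.+1) \is a fin_num.
  rewrite ge0_fin_numE//; apply: le_lt_trans (step_fin sm).
  by apply: le_leb => //; exact: step_mble.
have aeE k : {ae mu, forall t : lebR R, E k.+1 t -> mass (E k.+1) t < mu (E k.+1)}.
  pose F := [set t | E k.+1 t /\ mass (E k.+1) t < mu (E k.+1)].
  have mF : mble F by apply: mass_lt_mble.
  have FE : mu F = mu (E k.+1).
    rewrite /F (leb_mass_lt (@E_mble k.+1) (@E_gt0 k.+1) (measure_ge0 mu _)).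
    exact: minxx.
  exists (E k.+1 `\` F); split; first exact: measurableD.
    have Eoo : mu (E k.+1) < +oo by rewrite -ge0_fin_numE.
    by rewrite lebD// ?FE ?subee// => t [].
  move=> t /= /not_implyP[Et nF]; split=> // -[_]; exact: nF.
have := ae_foralln aeE; apply: filterS => t + Dt k km.
case mt : (m t) km => [|j]//; rewrite ltnS => kj /(_ j) Ej.
have mtj : E j.+1 t by split.
rewrite /sigma mt; apply: lt_le_trans (_ : mu (level m j) <= _); last first.
  by apply: le_leb; [exact: step_mble..|exact: le_level].
rewrite (_ : level m j = [set t | D t /\ (j < m t)%N])// geqE lebU//; last exact: step_mble.
by rewrite [X in _ < X]addeC lteD2lE//; exact: Ej.
Qed.

End Rank.

Lemma le_dist f : Mfun L f -> forall lam lam', (lam <= lam')%R -> dist f lam' <= dist f lam.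
Proof.
move=> mf lam lam' ll; apply: le_leb; [exact: Mfun_gt..|move=> t [Dt lt]].
by split=> //; apply: le_lt_trans lt; rewrite lee_fin.
Qed.

(** Right continuity of the distribution function: the superlevel set at [lam] is the increasing
    union of those at [lam + 1/(n+1)]. *)
Lemma dist_rcont f (lam : R) c : Mfun L f -> (0 <= lam)%R ->
  (forall n, dist f (lam + n.+1%:R^-1) <= c) -> dist f lam <= c.
Proof.
move=> mf lam0 fc; rewrite /dist (_ : [set _ | _] =
    \bigcup_n [set t | D t /\ (lam + n.+1%:R^-1)%:E < f t]); last first.
  apply/seteqP; split=> s.
    move=> [Ds lg]; have lam0E : 0 <= lam%:E by rewrite lee_fin.
    have [x /andP[lx xg]] := ge0_ereal_between lam0E lg.
    have [n nx] := ltr_add_invr lx.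
    by exists n => //; split=> //; apply: lt_trans xg; rewrite lte_fin.
  move=> [n _ [Ds lg]]; split=> //; apply: lt_trans lg.
  by rewrite lte_fin ltrDl invr_gt0.
apply: leb_bigcup_le => [n|n k nk s [Ds ls]|n]; [exact: Mfun_gt| |exact: fc].
split=> //; apply: le_lt_trans ls; rewrite lee_fin lerD2l lef_pV2 ?posrE//.
by rewrite ler_nat ltnS.
Qed.

(** [equimeasurable] tests positive levels only; right continuity adds the level 0, where the
    supports are compared. *)
Lemma le_dist0 f g : Mfun L f -> Mfun L g ->
  (forall lam, (0 < lam)%R -> dist f lam <= dist g lam) ->
  forall lam, (0 <= lam)%R -> dist f lam <= dist g lam.
Proof.
move=> mf mg fg lam lam0; apply: dist_rcont => // n.
have n0 : (0 < n.+1%:R^-1 :> R)%R by rewrite invr_gt0.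
apply: le_trans (fg _ _) _; first by rewrite ltr_wpDl.
by apply: le_dist => //; rewrite lerDl ltW.
Qed.

(* The decreasing rearrangement of [g] evaluated along [sigma]. *)
Definition transfer (sigma g : R -> \bar R) (t : R) : \bar R :=
  ereal_sup (0 |` [set lam%:E | lam in [set lam | (0 <= lam)%R /\ sigma t < dist g lam]]).

(** Right continuity of [dist g] moves the strict inequality [sigma t < dist g lam] to a slightly
    larger level, so the supremum defining the transfer exceeds [lam] strictly. *)
Lemma lt_transfer sigma g t (lam : R) : Mfun L g -> (0 <= lam)%R ->
  (lam%:E < transfer sigma g t) = (sigma t < dist g lam).
Proof.
move=> mg lam0; apply/idP/idP.
  move=> /ereal_sup_gt[x [->|[lam' [lam'0 st] <-]]].
    by rewrite lte_fin ltNge lam0.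
  by rewrite lte_fin => /ltW/(le_dist mg); exact: lt_le_trans.
move=> st; suff [n stn] : exists n : nat, sigma t < dist g (lam + n.+1%:R^-1).
  apply: (@lt_le_trans _ _ (lam + n.+1%:R^-1)%:E).
    by rewrite lte_fin ltrDl invr_gt0.
  apply: ereal_sup_ubound; right; exists (lam + n.+1%:R^-1)%R => //; split=> //.
  by rewrite addr_ge0.
apply: contrapT => /forallNP H; move: st; apply/negP; rewrite -leNgt.
by apply: dist_rcont => // n; rewrite leNgt; apply/negP/H.
Qed.

Lemma transfer_ge0 sigma g t : 0 <= transfer sigma g t.
Proof. by apply: ereal_sup_ubound; left. Qed.

Section Transfer.
Variables (sigma : R -> \bar R) (g : R -> \bar R).
Hypotheses (rs : ranked sigma (mu D)) (mg : Mfun L g).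

Lemma transfer_set (lam : R) : (0 <= lam)%R ->
  [set t | D t /\ lam%:E < transfer sigma g t] =
  [set t | D t /\ sigma t < dist g lam].
Proof. by move=> lam0; apply/seteqP; split=> t /= [Dt]; rewrite lt_transfer. Qed.

Lemma dist_transfer (lam : R) : (0 <= lam)%R -> dist (transfer sigma g) lam = dist g lam.
Proof.
move=> lam0; rewrite /dist transfer_set// (ranked_leb rs)// /mine.
case: ltP => //; rewrite -/(dist g lam) => le1; apply/eqP; rewrite eq_le le1/=.
by apply: le_leb => //; [exact: Mfun_gt|move=> t []].
Qed.

Lemma transfer_pos : pos (transfer sigma g).
Proof.
split; last by move=> t _; exact: transfer_ge0.
apply: MfunP => y; have [y0|y0] := leP 0%R y.
  by rewrite transfer_set//; exact: ranked_mble rs _.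
rewrite (_ : [set _ | _] = D)//; apply/seteqP; split=> [t []//|t Dt]; split=> //.
by apply: lt_le_trans (transfer_ge0 _ _ _); rewrite lte_fin.
Qed.

End Transfer.

(* Integer-valued analogue of [transfer]. *)
Definition stack (K : nat) (c : nat -> \bar R) (s : \bar R) : nat :=
  \sum_(k < K) (s < c k)%E.

Lemma ltn_stack K c s k : (forall i j, (i <= j)%N -> c j <= c i) ->
  (k < stack K c s)%N = (k < K)%N && (s < c k).
Proof.
move=> dc; elim: K => [|K IH]; first by rewrite /stack big_ord0.
rewrite /stack big_ord_recr/= -/(stack K c s).
have [sK|Ks] := boolP (s < c K).
  have -> : stack K c s = K.
    rewrite /stack -[RHS](card_ord K) -sum1_card; apply: eq_bigr => i _.
    by rewrite (lt_le_trans sK)// dc// ltnW.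
  rewrite addn1; case: (ltnP k K.+1) => //=; rewrite ltnS => kK.
  by rewrite (lt_le_trans sK)// dc.
rewrite addn0 IH ltnS; case: (ltngtP k K) => //= ->.
by rewrite (negbTE Ks).
Qed.

End Rearrangement.

Lemma approx_measurable d (T : measurableType d) (R : realType) (A : set T)
    (f : T -> \bar R) n :
  measurable A -> measurable_fun A f -> measurable_fun A (approx A f n).
Proof. by move=> mA mf; rewrite -(nnsfun_approxE mA mf); exact: measurable_funP. Qed.

(** * Functionals continuous along increasing sequences *)

Section Functional.
Context {R : realType}.
Local Notation mble := (@measurable _ (lebR R)).
Local Notation mu := (leb R).
Variable L : \bar R.
Local Notation D := (dom L).
Local Notation pos := (@pos R L).
Local Notation dist := (@dist R L).
Local Notation level := (@level R L).
Local Notation step := (@step R L).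
Local Notation transfer := (@transfer R L).

(** * Dyadic approximation from below *)

Definition dyad (n k : nat) : \bar R := (k%:R / 2 ^+ n)%:E.

Lemma dyad_ge0 n k : 0 <= dyad n k.
Proof. by rewrite lee_fin divr_ge0// exprn_ge0. Qed.

Lemma le_dyad n k l : (dyad n k <= dyad n l) = (k <= l)%N.
Proof. by rewrite lee_fin ler_pM2r ?ler_nat// invr_gt0 exprn_gt0. Qed.

Lemma lt_dyad n k l : (dyad n k < dyad n l) = (k < l)%N.
Proof. by rewrite ltNge le_dyad -ltnNge. Qed.

Lemma step_pos n m : step m -> pos (fun t => dyad n (m t)).
Proof.
move=> sm; split; last by move=> t _; exact: dyad_ge0.
apply: MfunP => y; have [y0|y0] := ltP y 0%R.
  rewrite (_ : [set _ | _] = D); first exact: dom_mble.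
  apply/seteqP; split=> [t []//|t Dt]; split=> //.
  by apply: lt_le_trans (dyad_ge0 _ _); rewrite lte_fin.
rewrite (_ : [set _ | _] = level m (Num.truncn (y * 2 ^+ n))); first exact: step_mble.
apply/seteqP; split=> t /= [Dt]; rewrite /level/= ?lte_fin ltr_pdivlMr ?exprn_gt0//.
  move=> ym; split=> //; rewrite -(ltr_nat R); apply: le_lt_trans ym.
  by rewrite truncn_le// mulr_ge0// exprn_ge0.
move=> ym; split=> //; apply: lt_le_trans (truncnS_gt _) _.
by rewrite ler_nat.
Qed.

Record dyadic_approximation (f : R -> \bar R) (m : nat -> R -> nat) : Prop := {
  da_step : forall n, step (m n);
  da_homo : forall t, D t -> nondecreasing_seq (fun n => dyad n (m n t));
  da_le : forall t, D t -> forall n, dyad n (m n t) <= f t;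
  da_cvg : forall t, D t -> dyad n (m n t) @[n --> \oo] --> f t }.

Section Approx.
Variables (f : R -> \bar R) (pf : pos f).
Let T := lebR R.
Let A n k : set T := @dyadic_approx _ T R D f n k.
Let B n : set T := @integer_approx _ T R D f n.
Let a (n : nat) (t : R) : R := @approx _ T R D f n t.
(** Numerator over [2 ^ n] of the usual simple approximation [approx]. The cut at [t < n] gives the
    support finite measure when [L] is infinite. *)
Let m (n : nat) (t : R) : nat := if `[< D t /\ (t < n%:R)%R >] then
  (\sum_(k < n * 2 ^ n) k * ((t : T) \in A n k) + n * 2 ^ n * ((t : T) \in B n))%N
  else 0%N.

Let dyad_m n t : D t -> (t < n%:R)%R -> dyad n (m n t) = (a n t)%:E.
Proof.
move=> Dt tn; rewrite /m; case: asboolP => [_|[]//]; rewrite /dyad /a /approx.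
congr (_%:E); rewrite natrD mulrDl; congr (_ + _)%R.
  rewrite natr_sum mulr_suml; apply: eq_bigr => k _.
  by rewrite natrM indicE mulrAC.
by rewrite !natrM natrX indicE mulrAC mulfK// expf_neq0.
Qed.

Let dyad_m0 n t : ~ (t < n%:R)%R -> dyad n (m n t) = 0.
Proof.
move=> tn; rewrite /m; case: asboolP => [[]//|_].
by rewrite /dyad mul0r.
Qed.

Let a_mble n (y : R) : mble [set t | D t /\ (y < a n t)%R].
Proof.
have ma : @measurable_fun _ _ T _ D (a n).
  exact: (@approx_measurable _ T R D f n (@dom_mble R L) pf.1).
have := ma (@dom_mble R L) [set` `]y, +oo[] (measurable_itv _).
congr (mble _); apply/seteqP; split=> t /= [Dt]; rewrite in_itv/= ?andbT => ?; by split.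
Qed.

Let levelE n k : level (m n) k =
  [set t | D t /\ (k%:R / 2 ^+ n < a n t)%R] `&` itv_oo 0 n%:R%:E.
Proof.
apply/seteqP; split=> t.
  move=> [Dt km]; have [tn|tn] := ltP t n%:R%R; last first.
    move: km; rewrite -(lt_dyad n) dyad_m0; last by apply/negP; rewrite -leNgt.
    by rewrite ltNge dyad_ge0.
  split; last by apply/andP; rewrite !lte_fin (dom_gt0 Dt).
  by split=> //; rewrite -lte_fin -dyad_m// lt_dyad.
move=> [[Dt ka] /andP[_ tn]]; split=> //.
by rewrite -(lt_dyad n) dyad_m.
Qed.

Lemma approx_exists : exists m, dyadic_approximation f m.
Proof.
exists m; split.
- move=> n; split.
  + move=> k; rewrite levelE.
    by apply: measurableI; [exact: a_mble|exact: itv_oo_mble].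
  + apply: (@le_lt_trans _ _ (mu (itv_oo 0 n%:R%:E))); last by rewrite leb_itv_oo// ltry.
    rewrite levelE; apply: le_leb; [|exact: itv_oo_mble|exact: subIsetr].
    by apply: measurableI; [exact: a_mble|exact: itv_oo_mble].
  + exists (\sum_(k < n * 2 ^ n) k + n * 2 ^ n)%N => t; rewrite /m.
    case: asboolP => // _; apply: leq_add.
      by apply: leq_sum => k _; case: (_ \in _); rewrite ?muln1 ?muln0.
    by case: (_ \in _); rewrite ?muln1 ?muln0.
- move=> t Dt n n' nn'; have [tn|tn] := boolP (t < n%:R)%R.
    have tn' : (t < n'%:R)%R by rewrite (lt_le_trans tn)// ler_nat.
    rewrite !dyad_m// lee_fin; have := @nd_approx _ T R D f _ _ nn'.
    by move=> /lefP/(_ t).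
  by rewrite dyad_m0 ?dyad_ge0//; exact/negP.
- move=> t Dt n; have [tn|tn] := boolP (t < n%:R)%R.
    by rewrite dyad_m//; apply: le_approx => //; exact: pf.2.
  by rewrite dyad_m0 ?pf.2//; exact/negP.
- move=> t Dt; apply: cvg_trans (@ecvg_approx _ T R D f pf.2 t Dt).
  apply: near_eq_cvg; near=> n; rewrite /= dyad_m//.
  by near: n; exact: nbhs_infty_gtr.
Unshelve. all: by end_near. Qed.

End Approx.

(** The properties shared by [X] and by [X] composed with the kernel operator. The Fatou property is
    stated through an upper bound [c], the form that survives a supremum over rearrangements. *)
Record regular (N : (R -> \bar R) -> \bar R) : Prop := Regular {
  regular_mono : forall f g, pos f -> pos g ->
    {ae mu, forall t : lebR R, D t -> f t <= g t} -> N f <= N g;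
  regular_fatou : forall (f_ : nat -> R -> \bar R) f, (forall n, pos (f_ n)) -> pos f ->
    (forall t, D t -> nondecreasing_seq (f_ ^~ t)) ->
    (forall t, D t -> f_ n t @[n --> \oo] --> f t) ->
    forall c, (forall n, N (f_ n) <= c) -> N f <= c }.

(** * Comparing distribution functions under a regular functional *)

Section Regular.
Variable N : (R -> \bar R) -> \bar R.
Hypothesis rN : regular N.

(** At a point of value [k.+1], the rank is below [mu (level (m n) k)], and [h] exceeds every
    [r < dyad n k.+1] on that level set. Hence the rank is below [dist h r <= dist g r], which by
    [lt_transfer] puts the transfer above [r]. *)
Lemma le_transfer h g m n sigma : pos h -> pos g -> dyadic_approximation h m ->
  (forall lam, (0 < lam)%R -> dist h lam <= dist g lam) ->
  {ae mu, forall t : lebR R, D t -> forall k, (k < m n t)%N ->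
     sigma t < mu (level (m n) k)} ->
  {ae mu, forall t : lebR R, D t -> dyad n (m n t) <= transfer sigma g t}.
Proof.
move=> ph pg dam hg; apply: filterS => t st Dt; rewrite leNgt; apply/negP => lt.
move: (st Dt); case mt : (m n t) lt => [|k] lt {}st.
  by move: lt; rewrite /dyad mul0r ltNge transfer_ge0.
have := st k (leqnn _).
have x0 : 0 <= maxe (transfer sigma g t) (dyad n k) by rewrite le_max transfer_ge0.
have [|r /andP[]] := @ge0_ereal_between _ _ (dyad n k.+1) x0.
  by rewrite gt_max lt lt_dyad ltnS leqnn.
rewrite gt_max => /andP[tr kr] rk stk.
have r0 : (0 <= r)%R by rewrite -lee_fin ltW// (le_lt_trans (dyad_ge0 n k)).
suff : r%:E < transfer sigma g t by rewrite ltNge ltW.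
rewrite lt_transfer//; last exact: pg.1.
apply: lt_le_trans stk (le_trans _ (le_dist0 ph.1 pg.1 hg r0)).
apply: le_leb; [exact: (step_mble (da_step dam n))|exact: Mfun_gt ph.1|].
move=> s [Ds ks]; split=> //; apply: lt_le_trans rk (le_trans _ (da_le dam Ds n)).
by rewrite le_dyad.
Qed.

(** Each dyadic approximation of [h] lies below the transfer of [g] along its own rank, and that
    transfer is a rearrangement of [g]. *)
Lemma regular_majorant h g c : pos h -> pos g ->
  (forall lam, (0 < lam)%R -> dist h lam <= dist g lam) ->
  (forall h', pos h' -> (forall lam, (0 < lam)%R -> dist h' lam = dist g lam) ->
     N h' <= c) ->
  N h <= c.
Proof.
move=> ph pg hg Nc; have [m dam] := approx_exists ph.
apply: (regular_fatou rN _ ph (da_homo dam) (da_cvg dam)) => n.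
  exact: step_pos (da_step dam n).
have [sigma rs st] := rank_exists (da_step dam n).
apply: (@le_trans _ _ (N (transfer sigma g))).
  apply: regular_mono rN _ _ _ _ _; [exact: step_pos (da_step dam n)| |].
    exact: transfer_pos rs pg.1.
  exact: le_transfer hg st.
apply: Nc; first exact: transfer_pos rs pg.1.
by move=> lam lam0; rewrite dist_transfer ?ltW//; exact: pg.1.
Qed.

(** Distribution functions are continuous along increasing sequences, so a level [r] above the
    transfers of all the [f_ n] stays above the transfer of the limit. *)
Lemma transfer_cvg sigma (f_ : nat -> R -> \bar R) f t :
  (forall n, pos (f_ n)) -> pos f ->
  (forall t, D t -> nondecreasing_seq (f_ ^~ t)) ->
  (forall t, D t -> f_ n t @[n --> \oo] --> f t) ->
  nondecreasing_seq (fun n => transfer sigma (f_ n) t) /\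
  transfer sigma (f_ n) t @[n --> \oo] --> transfer sigma f t.
Proof.
move=> pf_ pf ndf cf.
have lef n s : D s -> f_ n s <= f s.
  move=> Ds; have /cvg_unique := cf s Ds.
  move=> /(_ _ _ (ereal_nondecreasing_cvgn (ndf s Ds))) -> //.
  by apply: ereal_sup_ubound; exists n.
have le_tr g1 g2 : pos g1 -> pos g2 -> (forall s, D s -> g1 s <= g2 s) ->
    transfer sigma g1 t <= transfer sigma g2 t.
  move=> pg1 pg2 g12; apply: le_ereal_sup => _ [->|[lam [lam0 stl] <-]]; first by left.
  right; exists lam => //; split=> //; apply: lt_le_trans stl _.
  apply: le_leb; [exact: Mfun_gt pg1.1|exact: Mfun_gt pg2.1|move=> s [Ds ls]].
  by split=> //; apply: lt_le_trans ls (g12 _ Ds).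
have nd : nondecreasing_seq (fun n => transfer sigma (f_ n) t).
  by move=> n k nk; apply: le_tr => // s Ds; exact: ndf.
split=> //; have := ereal_nondecreasing_cvgn nd; set S := ereal_sup _.
suff -> : S = transfer sigma f t by [].
apply/eqP; rewrite eq_le; apply/andP; split.
  by apply: ge_ereal_sup => _ [n _ <-]; apply: le_tr => // s; exact: lef.
rewrite leNgt; apply/negP => Sf.
have S0 : 0 <= S.
  apply: le_trans (transfer_ge0 L sigma (f_ 0%N) t) _.
  by apply: ereal_sup_ubound; exists 0%N.
have [r /andP[Sr rf]] := ge0_ereal_between S0 Sf.
have r0 : (0 <= r)%R by rewrite -lee_fin ltW// (le_lt_trans S0).
move: rf; rewrite lt_transfer//; last exact: pf.1.
apply/negP; rewrite -leNgt /dist (_ : [set _ | _] =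
    \bigcup_n [set s | D s /\ r%:E < f_ n s]); last first.
  apply/seteqP; split=> s; last first.
    by move=> [n _ [Ds rs]]; split=> //; exact: lt_le_trans rs (lef _ _ Ds).
  move=> [Ds rs]; apply: contrapT => H; move: rs; apply/negP; rewrite -leNgt.
  rewrite -(cvg_lim _ (cf s Ds))//; apply: lime_le.
    by apply/cvg_ex; exists (f s); exact: cf.
  by apply: nearW => n; rewrite leNgt; apply/negP => rn; apply: H; exists n.
apply: leb_bigcup_le => [n|n k nk s [Ds rs]|n]; first exact: Mfun_gt (pf_ n).1.
  by split=> //; apply: lt_le_trans rs (ndf _ Ds _ _ nk).
rewrite -/(dist (f_ n) r) leNgt -lt_transfer//; last exact: (pf_ n).1.
rewrite -leNgt; apply: le_trans (ltW Sr); apply: ereal_sup_ubound.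
by exists n.
Qed.

(** Two limits are taken: [h] is replaced by a dyadic approximation, and then every [f_ k] is
    transferred along the one rank of that approximation, so that the transfers still increase with
    [k]. *)
Lemma regular_sup_fatou (f_ : nat -> R -> \bar R) f h c :
  (forall n, pos (f_ n)) -> pos f -> pos h ->
  (forall t, D t -> nondecreasing_seq (f_ ^~ t)) ->
  (forall t, D t -> f_ n t @[n --> \oo] --> f t) ->
  (forall lam, (0 < lam)%R -> dist h lam <= dist f lam) ->
  (forall n h', pos h' -> (forall lam, (0 < lam)%R -> dist h' lam = dist (f_ n) lam) ->
     N h' <= c) ->
  N h <= c.
Proof.
move=> pf_ pf ph ndf cf hf Nc; have [m dam] := approx_exists ph.
apply: (regular_fatou rN _ ph (da_homo dam) (da_cvg dam)) => n.
  exact: step_pos (da_step dam n).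
have [sigma rs st] := rank_exists (da_step dam n).
apply: (@le_trans _ _ (N (transfer sigma f))).
  apply: regular_mono rN _ _ _ _ _; [exact: step_pos (da_step dam n)| |].
    exact: transfer_pos rs pf.1.
  exact: le_transfer hf st.
have tc t := transfer_cvg sigma t pf_ pf ndf cf.
apply: (regular_fatou rN (f_ := fun k => transfer sigma (f_ k))) => [k||t _|t _|k].
- exact: transfer_pos rs (pf_ k).1.
- exact: transfer_pos rs pf.1.
- exact: (tc t).1.
- exact: (tc t).2.
apply: (Nc k); first exact: transfer_pos rs (pf_ k).1.
by move=> lam lam0; rewrite dist_transfer ?ltW//; exact: (pf_ k).1.
Qed.

End Regular.
End Functional.

(** * Subadditivity under rearrangement *)

Section Split.
Context {R : realType}.
Local Notation mble := (@measurable _ (lebR R)).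
Local Notation mu := (leb R).
Variable L : \bar R.
Local Notation D := (dom L).
Local Notation pos := (@pos R L).
Local Notation dist := (@dist R L).
Local Notation level := (@level R L).
Local Notation step := (@step R L).

(** * Step functions with the same distribution *)

Section SameLaw.
Variables p q : R -> nat.
Hypotheses (sp : step p) (mq : forall k, mble (level q k))
  (pq : forall k, mu (level p k) = mu (level q k)).

Let fiber (r : R -> nat) k := [set t | D t /\ r t = k.+1].

Let fiberE r k : fiber r k = level r k `\` level r k.+1.
Proof.
apply/seteqP; split=> t.
  by move=> [Dt rt]; split; [split=> //; rewrite rt|move=> []; rewrite rt ltnn].
move=> [[Dt kr] nk]; split=> //; apply/eqP; rewrite eqn_leq kr andbT leqNgt.
by apply/negP => kr'; apply: nk.
Qed.

Let fiber_mble r k : (forall k, mble (level r k)) -> mble (fiber r k).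
Proof. by move=> mr; rewrite fiberE; exact: measurableD. Qed.

Let leb_fiber k : mu (fiber p k) = mu (fiber q k).
Proof.
have mp := step_mble sp.
have pfin : mu (level p k) < +oo.
  by apply: le_lt_trans (step_fin sp); apply: le_leb => //; exact: le_level.
rewrite !fiberE !lebD//; try exact: le_level.
  by rewrite !pq.
by rewrite -pq.
Qed.

(** The value 0 is left out because [phi 0 = 0] keeps it out of the superlevel sets; what remains is
    a finite union of fibers. *)
Let part (r : R -> nat) (S : set nat) k := [set t | D t /\ S (r t) /\ (0 < r t <= k)%N].

Let part0 r S : part r S 0 = set0.
Proof. by apply/seteqP; split=> // t [_ [_ /andP[/leq_trans/[apply]]]]. Qed.

Let partS r (S : set nat) k : part r S k.+1 =
  part r S k `|` (if `[< S k.+1 >] then fiber r k else set0).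
Proof.
apply/seteqP; split=> t.
  move=> [Dt [St /andP[t0]]]; rewrite leq_eqVlt => /predU1P[tk|tk].
    by right; rewrite -tk; case: asboolP.
  by left; split=> //; split=> //; rewrite t0.
case; first by move=> [Dt [St /andP[t0 tk]]]; split=> //; split=> //; rewrite t0 ltnW.
case: asboolP => // Sk [Dt rt]; split=> //; rewrite rt; split=> //.
by rewrite leqnn.
Qed.

Let part_mble r S k : (forall k, mble (level r k)) -> mble (part r S k).
Proof.
move=> mr; elim: k => [|k IH]; first by rewrite part0.
rewrite partS; apply: measurableU => //.
by case: asboolP => // _; exact: fiber_mble.
Qed.

Let leb_partS r S k : (forall k, mble (level r k)) -> mu (part r S k.+1) =
  mu (part r S k) + (if `[< S k.+1 >] then mu (fiber r k) else 0).
Proof.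
move=> mr; rewrite partS lebU; [|exact: part_mble| |].
- by case: asboolP => // _; rewrite measure0.
- by case: asboolP => // _; exact: fiber_mble.
- apply/seteqP; split=> // t [[_ [_ /andP[_ tk]]]].
  by case: asboolP => // _ [_ rt]; move: tk; rewrite rt ltnn.
Qed.

Let leb_part S k : mu (part p S k) = mu (part q S k).
Proof.
elim: k => [|k IH]; first by rewrite !part0.
rewrite !leb_partS//; last exact: step_mble.
by rewrite IH leb_fiber.
Qed.

Variable M : nat.
Hypotheses (pM : forall t, (p t <= M)%N) (qM : forall t, (q t <= M)%N).
Variable phi : nat -> \bar R.
Hypothesis (phi0 : phi 0 = 0) (phi_ge0 : forall k, 0 <= phi k).

Let superlevelE r (lam : R) : (0 <= lam)%R -> (forall t, (r t <= M)%N) ->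
  [set t | D t /\ lam%:E < phi (r t)] = part r [set k | lam%:E < phi k] M.
Proof.
move=> lam0 rM; apply/seteqP; split=> t; last by move=> [Dt []].
move=> [Dt lt]; split=> //; split=> //; rewrite rM andbT lt0n; apply/eqP => r0.
by move: lt; rewrite r0 phi0 lte_fin ltNge lam0.
Qed.

(** [phi] may fail to be monotone, as do the coordinates of an encoded pair. Its superlevel sets are
    therefore cut into fibers, whose measures are differences of level measures. *)
Lemma same_law_dist (lam : R) : (0 <= lam)%R ->
  dist (fun t => phi (p t)) lam = dist (fun t => phi (q t)) lam.
Proof. by move=> lam0; rewrite /dist !superlevelE. Qed.

Lemma same_law_pos : pos (fun t => phi (q t)).
Proof.
split; last by move=> t _; exact: phi_ge0.
apply: MfunP => y; have [y0|y0] := ltP y 0%R; last first.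
  by rewrite superlevelE//; exact: part_mble.
rewrite (_ : [set _ | _] = D); first exact: dom_mble.
apply/seteqP; split=> [t []//|t Dt]; split=> //.
by apply: lt_le_trans (phi_ge0 _); rewrite lte_fin.
Qed.

End SameLaw.

Lemma level_comp_mble (i j : R -> nat) (F : nat -> nat -> nat) k :
  step i -> step j -> mble (level (fun t => F (i t) (j t)) k).
Proof.
move=> si sj.
have fib r : step r -> forall a, mble [set t | D t /\ r t = a].
  move=> sr [|a].
    rewrite (_ : [set _ | _] = D `\` level r 0).
      by apply: measurableD; [exact: dom_mble|exact: step_mble].
    apply/seteqP; split=> t.
      by move=> [Dt rt]; split=> // -[_]; rewrite rt.
    by move=> [Dt n0]; split=> //; apply/eqP; rewrite -leqn0 leqNgt; apply/negP => ?; apply: n0.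
  rewrite (_ : [set _ | _] = level r a `\` level r a.+1).
    by apply: measurableD; exact: step_mble.
  apply/seteqP; split=> t.
    by move=> [Dt rt]; split; [split=> //; rewrite rt|move=> []; rewrite rt ltnn].
  move=> [[Dt kr] nk]; split=> //; apply/eqP; rewrite eqn_leq kr andbT leqNgt.
  by apply/negP => kr'; apply: nk.
rewrite (_ : level _ k = \bigcup_a \bigcup_(b in [set b | (k < F a b)%N])
    ([set t | D t /\ i t = a] `&` [set t | D t /\ j t = b])).
  apply: bigcupT_measurable => a; apply: bigcup_measurable => b _.
  by apply: measurableI; exact: fib.
apply/seteqP; split=> t.
  by move=> [Dt kF]; exists (i t) => //; exists (j t).
by move=> [a _ [b kF [[Dt ia] [_ jb]]]]; split=> //; rewrite ia jb.
Qed.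

(** * Splitting a rearrangement of a sum *)

Section Subadditive.
Variable N : (R -> \bar R) -> \bar R.
Hypotheses (rN : regular L N)
  (subN : forall f g, pos f -> pos g -> N (fun t => f t + g t) <= N f + N g).

Lemma pos_add f g : pos f -> pos g -> pos (fun t => f t + g t).
Proof.
move=> [mf f0] [mg g0]; split; first exact: emeasurable_funD.
by move=> t Dt; rewrite adde_ge0 ?f0 ?g0.
Qed.

(* The pair [(i, j)] is encoded by the integer [(i + j) * M.+1 + i], which sorts it
   by [i + j] first; rearranging this code along the rank of [h] splits [h]. *)
Lemma regular_split_step n i j h cf cg : step i -> step j -> pos h ->
  (forall lam, (0 < lam)%R ->
     dist h lam <= dist (fun t => dyad n (i t) + dyad n (j t)) lam) ->
  (forall h', pos h' ->
     (forall lam, (0 < lam)%R -> dist h' lam = dist (fun t => dyad n (i t)) lam) ->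
     N h' <= cf) ->
  (forall h', pos h' ->
     (forall lam, (0 < lam)%R -> dist h' lam = dist (fun t => dyad n (j t)) lam) ->
     N h' <= cg) ->
  N h <= cf + cg.
Proof.
move=> si sj ph hij Nf Ng; have [m dam] := approx_exists ph.
apply: (regular_fatou rN _ ph (da_homo dam) (da_cvg dam)) => p.
  exact: step_pos (da_step dam p).
have [sigma rs st] := rank_exists (da_step dam p).
have [M iM] := step_bounded si; have [M' jM'] := step_bounded sj.
pose Q t := ((i t + j t) * M.+1 + i t)%N.
pose K := ((M + M') * M.+1 + M)%N.
have QK t : (Q t <= K)%N by rewrite leq_add// leq_mul2r leq_add ?orbT.
have mQ k : mble (level Q k).
  exact: (level_comp_mble (fun a b => ((a + b) * M.+1 + a)%N)).
have Q0 t : (0 < Q t)%N -> (0 < i t)%N \/ (0 < j t)%N.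
  by rewrite /Q; case: (i t) => [|a]; [case: (j t) => // b _; right|left].
have finQ : mu (level Q 0) < +oo.
  apply: (@le_lt_trans _ _ (mu (level i 0 `|` level j 0))).
    apply: le_leb => //; first by apply: measurableU; exact: step_mble.
    by move=> t [Dt /Q0[?|?]]; [left|right].
  apply: le_lt_trans (measureU2 _ _ _) _; [exact: step_mble..|].
  by apply: lte_add_pinfty; exact: step_fin.
have sQ : step Q by split=> //; exists K.
pose c k := mu (level Q k).
have dc a b : (a <= b)%N -> c b <= c a.
  by move=> ab; apply: le_leb => //; exact: le_level.
(* [q] is [Q] rearranged along [sigma]: its levels are sublevel sets of [sigma] with the measures of
   the levels of [Q]. *)
pose q t := stack K c (sigma t).
have qE k t : (k < q t)%N = (k < K)%N && (sigma t < c k) by exact: ltn_stack.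
have c0 k : (K <= k)%N -> c k = 0.
  move=> Kk; rewrite /c (_ : level Q k = set0) ?measure0//.
  by apply/seteqP; split=> // t [_ /leq_trans/(_ (QK t))]; rewrite ltnNge Kk.
have qlevel k : level q k = [set t | D t /\ sigma t < c k].
  apply/seteqP; split=> t; first by move=> [Dt]; rewrite qE => /andP[].
  move=> [Dt ct]; split=> //; rewrite qE ct andbT ltnNge; apply/negP => Kk.
  by move: ct; rewrite c0// ltNge (ranked_ge0 rs).
have mq k : mble (level q k) by rewrite qlevel; exact: ranked_mble rs _.
have lawq k : mu (level Q k) = mu (level q k).
  rewrite qlevel (ranked_leb rs) ?measure_ge0// min_l//.
  by apply: le_leb => //; [exact: dom_mble|move=> t []].
have qK t : (q t <= K)%N.
  by rewrite leqNgt; apply/negP; rewrite qE ltnn.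
(* Decoding: since [i t <= M], the remainder of [Q t] modulo [M.+1] is [i t] and the quotient is
   [i t + j t], so [phi1] and [phi2] recover the two summands. *)
pose phi1 k : \bar R := dyad n (k %% M.+1); pose phi2 k : \bar R := dyad n (k %/ M.+1 - k %% M.+1).
have Qmod t : (Q t %% M.+1 = i t)%N by rewrite /Q modnMDl modn_small// ltnS.
have Qdiv t : (Q t %/ M.+1 = i t + j t)%N.
  by rewrite /Q divnMDl// divn_small ?addn0// ltnS.
have phi10 : phi1 0%N = 0 by rewrite /phi1 mod0n /dyad mul0r.
have phi20 : phi2 0%N = 0 by rewrite /phi2 div0n /dyad mul0r.
have phi1_ge0 k : 0 <= phi1 k by exact: dyad_ge0.
have phi2_ge0 k : 0 <= phi2 k by exact: dyad_ge0.
have ph1 := same_law_pos mq qK phi10 phi1_ge0.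
have ph2 := same_law_pos mq qK phi20 phi2_ge0.
apply: (@le_trans _ _ (N (fun t => phi1 (q t) + phi2 (q t)))); last first.
  apply: le_trans (subN ph1 ph2) _; apply: leeD.
    apply: Nf => // lam lam0.
    rewrite -(same_law_dist sQ mq lawq QK qK phi10 (ltW lam0)).
    by congr (dist _ _); apply/funext => t; rewrite /phi1 Qmod.
  apply: Ng => // lam lam0.
  rewrite -(same_law_dist sQ mq lawq QK qK phi20 (ltW lam0)).
  by congr (dist _ _); apply/funext => t; rewrite /phi2 Qmod Qdiv addKn.
have dyadD a b : dyad n a + dyad n b = dyad n (a + b) :> \bar R.
  by rewrite /dyad -EFinD -mulrDl natrD.
apply: regular_mono rN _ _ _ _ _; [exact: step_pos (da_step dam p)|exact: pos_add|].
apply: filterS st => t st Dt; rewrite leNgt; apply/negP.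
rewrite /phi1 /phi2 dyadD; set d := (q t %/ M.+1)%N => lt0.
(* For the values of [q] the subtraction in [phi2] may truncate; the decoded sum is then still at
   least the quotient [d], the direction needed. *)
have lt : (dyad n d : \bar R) < dyad p (m p t).
  by apply: le_lt_trans lt0; rewrite le_dyad -leq_subLR.
move: (st Dt); case mt : (m p t) lt => [|k] lt {}st.
  by move: lt; rewrite {2}/dyad mul0r ltNge dyad_ge0.
have := st k (leqnn _).
have x0 : 0 <= maxe (dyad n d : \bar R) (dyad p k) by rewrite le_max dyad_ge0.
have [|r /andP[]] := @ge0_ereal_between _ _ (dyad p k.+1) x0.
  by rewrite gt_max lt lt_dyad ltnS leqnn.
rewrite gt_max => /andP[dr kr] rk stk.
have r0 : (0 <= r)%R by rewrite -lee_fin ltW// (le_lt_trans (dyad_ge0 p k)).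
(* [k0 < q t] means that the quotient of [q t] is at least [d.+1], against the definition of [d]; in
   the same way [k0 < Q s] as soon as [d < i s + j s]. *)
pose k0 := (d.+1 * M.+1).-1.
suff : (k0 < q t)%N.
  rewrite /k0 prednK ?muln_gt0// -leq_divRL//.
  by rewrite -/d ltnn.
suff : sigma t < c k0.
  move=> ct; rewrite qE ct andbT ltnNge; apply/negP => Kk.
  by move: ct; rewrite c0// ltNge (ranked_ge0 rs).
have pij := pos_add (step_pos n si) (step_pos n sj).
apply: lt_le_trans stk (le_trans _ (le_trans (le_dist0 ph.1 pij.1 hij r0) _)).
  apply: le_leb; [exact: (step_mble (da_step dam p))|exact: Mfun_gt ph.1|].
  move=> s [Ds ks]; split=> //; apply: lt_le_trans rk (le_trans _ (da_le dam Ds p)).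
  by rewrite le_dyad.
apply: le_leb; [exact: Mfun_gt pij.1|exact: mQ|].
move=> s [Ds]; rewrite dyadD => /(lt_trans dr); rewrite lt_dyad => ds; split=> //.
by rewrite /k0 prednK ?muln_gt0// (leq_trans _ (leq_addr _ _))// leq_mul2r ds orbT.
Qed.

Lemma regular_split f g h cf cg : pos f -> pos g -> pos h ->
  (forall lam, (0 < lam)%R -> dist h lam <= dist (fun t => f t + g t) lam) ->
  (forall h', pos h' -> (forall lam, (0 < lam)%R -> dist h' lam = dist f lam) ->
     N h' <= cf) ->
  (forall h', pos h' -> (forall lam, (0 < lam)%R -> dist h' lam = dist g lam) ->
     N h' <= cg) ->
  N h <= cf + cg.
Proof.
move=> pf pg ph hfg Nf Ng.
have [i dai] := approx_exists pf; have [j daj] := approx_exists pg.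
(* Rearrangements of a dyadic approximation have a smaller distribution than the function itself, so
   [regular_majorant] hands them the same bound. *)
have sub f' i' n c : pos f' -> dyadic_approximation L f' i' ->
    (forall h', pos h' -> (forall lam, (0 < lam)%R -> dist h' lam = dist f' lam) ->
     N h' <= c) ->
    forall h', pos h' -> (forall lam, (0 < lam)%R ->
      dist h' lam = dist (fun t => dyad n (i' n t)) lam) -> N h' <= c.
  move=> pf' da Nc h' ph' h'i; apply: (regular_majorant rN ph' pf') => // lam lam0.
  rewrite h'i//; apply: le_leb.
  - exact: Mfun_gt (step_pos n (da_step da n)).1.
  - exact: Mfun_gt pf'.1.
  - by move=> s [Ds ls]; split=> //; apply: lt_le_trans ls (da_le da Ds n).
have pos_ij n : pos (fun t => dyad n (i n t) + dyad n (j n t)).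
  by apply: pos_add; [exact: step_pos (da_step dai n)|exact: step_pos (da_step daj n)].
apply: (regular_sup_fatou rN pos_ij (pos_add pf pg) ph _ _ hfg) => [t Dt a b ab|t Dt|n h' ph' h'ij].
- by apply: leeD; [exact: (da_homo dai)|exact: (da_homo daj)].
- apply: cvgeD; [|exact: (da_cvg dai)|exact: (da_cvg daj)].
  by apply: ge0_adde_def; rewrite inE ?pf.2 ?pg.2.
apply: (regular_split_step (da_step dai n) (da_step daj n) ph').
- by move=> lam lam0; rewrite h'ij.
- exact: sub pf dai Nf.
- exact: sub pg daj Ng.
Qed.

End Subadditive.
End Split.

(** * The functional [varrho] *)

Section Operator.
Context {R : realType}.
Local Notation mble := (@measurable _ (lebR R)).
Local Notation mu := (leb R).
Variable L : \bar R.
Local Notation D := (dom L).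
Local Notation pos := (@pos R L).
Local Notation dist := (@dist R L).

Lemma Mfun_antitone (f : R -> \bar R) :
  (forall s t : R, D s -> D t -> (s <= t)%R -> f t <= f s) -> Mfun L f.
Proof.
move=> df; apply: MfunP => y; apply: interval_mble => a b [Da ya] [Db yb] c /andP[ac cb].
have Dc : D c.
  move: Da Db => /andP[a0 _] /andP[_ bL]; apply/andP; split.
    by apply: lt_le_trans a0 _; rewrite lee_fin.
  by apply: le_lt_trans bL; rewrite lee_fin.
by split=> //; apply: lt_le_trans yb _; exact: df.
Qed.

Lemma pos_abse f : Mfun L f -> pos (fun t => `|f t|).
Proof. by move=> mf; split=> //; exact: measurableT_comp. Qed.

Lemma pos_Mplus f : pos f -> Mplus L f.
Proof. by move=> [mf f0]; split=> //; exact: aeW. Qed.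
Hint Resolve pos_Mplus : core.

Lemma dist_abse f lam : pos f -> dist (fun t => `|f t|) lam = dist f lam.
Proof.
move=> pf; congr (mu _); apply/seteqP.
by split=> t /= [Dt]; rewrite gee0_abs ?pf.2// => ?; split.
Qed.

(** This rests on the completeness of Lebesgue measure on [lebR]. *)
Lemma ae_eq_Mfun f g : {ae mu, forall t : lebR R, D t -> f t = g t} ->
  Mfun L f -> Mfun L g.
Proof.
exact: (@ae_measurable_fun _ _ _ (leb R) completed_lebesgue_measure_is_complete).
Qed.

Lemma ae_le_dist f g (lam : R) : Mfun L f -> Mfun L g ->
  {ae mu, forall t : lebR R, D t -> f t <= g t} -> dist f lam <= dist g lam.
Proof.
move=> mf mg [Z [mZ Z0 fgZ]].
apply: (@le_trans _ _ (mu ([set t | D t /\ lam%:E < g t] `|` Z))).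
  apply: le_leb; [exact: Mfun_gt|apply: measurableU => //; exact: Mfun_gt|].
  move=> t [Dt lt]; have [?|nZ] := pselect (Z t); [by right|left; split=> //].
  apply: lt_le_trans lt _; have : ~ ~ (D t -> f t <= g t) by move=> /fgZ.
  by move=> /contrapT/(_ Dt).
by rewrite measureU0//; exact: Mfun_gt.
Qed.

Lemma ae_eq_dist f g (lam : R) : Mfun L f -> Mfun L g ->
  {ae mu, forall t : lebR R, D t -> f t = g t} -> dist f lam = dist g lam.
Proof.
move=> mf mg fg; apply/eqP; rewrite eq_le !ae_le_dist//.
  by apply: filterS fg => t h Dt; rewrite h.
by apply: filterS fg => t h Dt; rewrite h.
Qed.

Section Norm.
Variable X : (R -> \bar R) -> \bar R.
Hypothesis X_ri : is_ri_norm L X.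

Lemma rin_eq f g : Mplus L f -> Mplus L g ->
  {ae mu, forall t : lebR R, D t -> f t = g t} -> X f = X g.
Proof.
move=> pf pg fg; apply/eqP; rewrite eq_le !(rin_mono X_ri)//.
  by apply: filterS fg => t h Dt; rewrite h.
by apply: filterS fg => t h Dt; rewrite h.
Qed.

Lemma rin_regular : regular L X.
Proof.
split=> [f g pf pg fg|f_ f pf_ pf ndf cf c Xc]; first by apply: rin_mono => //; auto.
have [_ cX] : nondecreasing_seq (fun k => X (f_ k)) /\ X (f_ k) @[k --> \oo] --> X f.
  by apply: (rin_cvg X_ri) => //; [move=> k; auto|auto|apply: aeW => t Dt; split; auto].
rewrite -(cvg_lim _ cX)//; apply: lime_le; last exact: nearW.
by apply/cvg_ex; exists (X f).
Qed.

(** By rearrangement invariance, [X g] itself is a bound for [X] on all rearrangements of [g]. *)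
Lemma rin_le_dist f g : pos f -> pos g ->
  (forall lam, (0 < lam)%R -> dist f lam <= dist g lam) -> X f <= X g.
Proof.
move=> pf pg fg; apply: (regular_majorant rin_regular pf pg fg) => h ph hg.
rewrite le_eqVlt; apply/orP; left; apply/eqP.
apply: (rin_equi X_ri); [by auto..|move=> lam lam0].
have := hg _ lam0; rewrite -(dist_abse _ ph) -(dist_abse _ pg); exact.
Qed.

End Norm.

Variables (u v nu : R -> R).
Hypotheses (u_gt0 : forall t, D t -> (0 < u t)%R)
  (v_gt0 : forall t, D t -> (0 < v t)%R)
  (u_noninc : {in D &, {homo u : s t /~ (s <= t)%R}})
  (v_noninc : {in D &, {homo v : s t /~ (s <= t)%R}})
  (nu_bij : set_bij D D nu)
  (nu_incr : {in D &, {homo nu : s t / (s < t)%R}}).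

Lemma nu_dom t : D t -> D (nu t).
Proof. by case: nu_bij => + _ _; exact. Qed.

Lemma nu_invK s : D s -> nu (nu_inv L nu s) = s.
Proof. by move=> Ds; case: nu_bij => _ _ sur; apply: (surjpK _ sur); rewrite inE. Qed.

Lemma nu_inv_dom s : D s -> D (nu_inv L nu s).
Proof.
move=> Ds; case: nu_bij => _ _ sur.
by apply: (@surjpinv_image_sub _ _ (fun=> point) D D nu sur); exists s.
Qed.

(** * The kernel operator on nonnegative functions *)

Definition tail (t : R) : set R := itv_oo (nu t)%:E L.

Definition kern (h : R -> \bar R) (t : R) : \bar R :=
  (u t)%:E * \int[mu]_(s in tail t) (h s * (v s)%:E).

Lemma u_le s t : D s -> D t -> (s <= t)%R -> (u t <= u s)%R.
Proof. by move=> Ds Dt; apply: u_noninc; rewrite inE. Qed.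

Lemma v_le s t : D s -> D t -> (s <= t)%R -> (v t <= v s)%R.
Proof. by move=> Ds Dt; apply: v_noninc; rewrite inE. Qed.

Lemma nu_le s t : D s -> D t -> (s <= t)%R -> (nu s <= nu t)%R.
Proof.
move=> Ds Dt; rewrite le_eqVlt => /predU1P[->//|st]; apply/ltW/nu_incr => //;
by rewrite inE.
Qed.

Lemma nu_lt s t : D s -> D t -> (nu s < nu t)%R = (s < t)%R.
Proof.
move=> Ds Dt; apply/idP/idP => [|st]; last by apply: nu_incr => //; rewrite inE.
by apply: contraTT; rewrite -!leNgt; exact: nu_le.
Qed.

Lemma u_pos : pos (fun t => (u t)%:E).
Proof.
split; last by move=> t Dt; rewrite lee_fin ltW ?u_gt0.
by apply: Mfun_antitone => s t Ds Dt st; rewrite lee_fin u_le.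
Qed.

Lemma v_Mfun : Mfun L (fun t => (v t)%:E).
Proof. by apply: Mfun_antitone => s t Ds Dt st; rewrite lee_fin v_le. Qed.

Lemma tail_mble t : mble (tail t).
Proof. exact: itv_oo_mble. Qed.
Hint Resolve tail_mble : core.

Lemma tail_dom t : D t -> tail t `<=` D.
Proof.
move=> /nu_dom/andP[nu0 _] s /andP[ns sL]; apply/andP; split=> //.
exact: lt_trans ns.
Qed.

Lemma weight_pos h : pos h -> pos (fun s => h s * (v s)%:E).
Proof.
move=> [mh h0]; split; first exact: (emeasurable_funM mh v_Mfun).
by move=> s Ds; rewrite mule_ge0 ?h0// lee_fin ltW ?v_gt0.
Qed.

Lemma tail_Mfun h t : D t -> Mfun L h ->
  @measurable_fun _ _ (lebR R) _ (tail t) (fun s => h s * (v s)%:E).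
Proof.
move=> Dt mh; apply: (@measurable_funS _ _ (lebR R) _ D); [exact: dom_mble|exact: tail_dom|].
exact: (emeasurable_funM mh v_Mfun).
Qed.

Lemma tail_ge0 h t : D t -> pos h -> forall s, tail t s -> 0 <= h s * (v s)%:E.
Proof. by move=> Dt ph s /(tail_dom Dt); exact: (weight_pos ph).2. Qed.

Lemma tail_int_ge0 h t : D t -> pos h -> 0 <= \int[mu]_(s in tail t) (h s * (v s)%:E).
Proof. by move=> Dt ph; apply: integral_ge0; exact: tail_ge0. Qed.

(** Measurability comes from monotonicity: [u] is nonincreasing and the tails shrink as [t]
    grows. *)
Lemma kern_pos h : pos h -> pos (kern h).
Proof.
move=> ph; split; last first.
  by move=> t Dt; rewrite mule_ge0 ?tail_int_ge0// lee_fin ltW ?u_gt0.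
apply: Mfun_antitone => s t Ds Dt st; apply: lee_pmul.
- by rewrite lee_fin ltW ?u_gt0.
- exact: tail_int_ge0.
- by rewrite lee_fin u_le.
apply: (@ge0_subset_integral _ _ _ (leb R) _ _ (tail_mble t) (tail_mble s) _ (tail_Mfun Ds ph.1)
  (tail_ge0 Ds ph)).
move=> x /andP[nx xL]; apply/andP; split=> //; apply: le_lt_trans nx.
by rewrite lee_fin nu_le.
Qed.

Lemma le_kern h1 h2 t : D t -> pos h1 -> pos h2 ->
  {ae mu, forall t : lebR R, D t -> h1 t <= h2 t} -> kern h1 t <= kern h2 t.
Proof.
move=> Dt p1 p2 h12; apply: lee_wpmul2l; first by rewrite lee_fin ltW ?u_gt0.
apply: (ae_ge0_le_integral (tail_mble t) (tail_ge0 Dt p1) (tail_Mfun Dt p1.1)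
  (tail_ge0 Dt p2) (tail_Mfun Dt p2.1)).
apply: filterS h12 => s h12 /(tail_dom Dt) Ds.
by apply: lee_wpmul2r; [rewrite lee_fin ltW ?v_gt0|exact: h12].
Qed.

Lemma kernD h1 h2 t : D t -> pos h1 -> pos h2 ->
  kern (fun s => h1 s + h2 s) t = kern h1 t + kern h2 t.
Proof.
move=> Dt p1 p2; rewrite /kern -ge0_muleDr ?tail_int_ge0//; congr (_ * _).
rewrite -(@ge0_integralD _ _ _ (leb R) _ (tail_mble t) _ _ (tail_ge0 Dt p1)
  (tail_Mfun Dt p1.1) (tail_ge0 Dt p2) (tail_Mfun Dt p2.1)).
apply: eq_integral => s; rewrite inE => /(tail_dom Dt) Ds.
by rewrite ge0_muleDl ?p1.2 ?p2.2.
Qed.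

Lemma kernZ h (c : R) t : D t -> pos h -> (0 <= c)%R ->
  kern (fun s => c%:E * h s) t = c%:E * kern h t.
Proof.
move=> Dt ph c0; rewrite /kern muleCA; congr (_ * _).
rewrite -(@ge0_integralZl _ _ _ (leb R) _ (tail_mble t) _ (tail_Mfun Dt ph.1) c%:E
  (tail_ge0 Dt ph)); last by rewrite lee_fin.
by apply: eq_integral => s _; rewrite muleA.
Qed.

Lemma kern_cvg (h_ : nat -> R -> \bar R) h t : D t ->
  (forall n, pos (h_ n)) -> pos h ->
  (forall s, D s -> nondecreasing_seq (h_ ^~ s)) ->
  (forall s, D s -> h_ n s @[n --> \oo] --> h s) ->
  kern (h_ n) t @[n --> \oo] --> kern h t.
Proof.
move=> Dt ph_ ph ndh ch; apply: cvgeZl => //.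
have vfin s : (v s)%:E \is a fin_num by [].
rewrite (_ : \int[mu]_(s in tail t) (h s * (v s)%:E) =
  \int[mu]_(s in tail t) (limn (fun n => h_ n s * (v s)%:E))); last first.
  apply: eq_integral => s; rewrite inE => /(tail_dom Dt) Ds.
  by apply/esym/cvg_lim => //; apply: cvgeZr => //; exact: ch.
apply: (cvg_monotone_convergence (mu := leb R) (tail_mble t)
  (fun n => tail_Mfun Dt (ph_ n).1) (fun n => tail_ge0 Dt (ph_ n))).
move=> s /(tail_dom Dt) Ds n k nk; apply: lee_wpmul2r; last exact: ndh.
by rewrite lee_fin ltW ?v_gt0.
Qed.

Variable X : (R -> \bar R) -> \bar R.
Hypothesis X_ri : is_ri_norm L X.

(** * Norm axioms for [varrho] *)

Definition kern_norm (h : R -> \bar R) : \bar R := X (kern h).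
Local Notation N := kern_norm.
Local Notation rho := (varrho L u v nu X).

Lemma kern_norm_regular : regular L N.
Proof.
split=> [f g pf pg fg|h_ h ph_ ph ndh ch c Nc].
  apply: (rin_mono X_ri); [apply/pos_Mplus/kern_pos => //..|].
  by apply: aeW => t Dt; exact: le_kern.
apply: (regular_fatou (rin_regular X_ri) (f_ := fun n => kern (h_ n))) => // [n||t Dt|t Dt].
- exact: kern_pos.
- exact: kern_pos.
- move=> n k nk; apply: le_kern => //; apply: aeW => s Ds; exact: ndh.
- exact: kern_cvg.
Qed.

Lemma kern_normD f g : pos f -> pos g -> N (fun t => f t + g t) <= N f + N g.
Proof.
move=> pf pg; apply: le_trans (rin_triangle X_ri _ _); last 2 first.
- by apply/pos_Mplus/kern_pos.
- by apply/pos_Mplus/kern_pos.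
rewrite le_eqVlt; apply/orP; left; apply/eqP; apply: (rin_eq X_ri).
- exact/pos_Mplus/kern_pos/pos_add.
- by apply/pos_Mplus/pos_add; exact: kern_pos.
- by apply: aeW => t Dt; exact: kernD.
Qed.

Lemma kern_norm_ge0 f : pos f -> 0 <= N f.
Proof. by move=> pf; apply: (rin_ge0 X_ri); exact/pos_Mplus/kern_pos. Qed.

Lemma le_varrho f h : pos h ->
  (forall lam, (0 < lam)%R -> dist h lam = dist (fun t => `|f t|) lam) -> N h <= rho f.
Proof.
move=> ph hf; apply: ereal_sup_ubound; exists h => //; split; first exact: pos_Mplus.
by move=> lam lam0; rewrite -[RHS]hf// -[RHS]dist_abse.
Qed.

(** The functions in the supremum are nonnegative only a.e.; passing to the absolute value changes
    neither their kernel on the domain nor their equimeasurability class. *)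
Lemma varrho_le f c :
  (forall h, pos h ->
     (forall lam, (0 < lam)%R -> dist h lam = dist (fun t => `|f t|) lam) -> N h <= c) ->
  rho f <= c.
Proof.
move=> Nc; apply: ge_ereal_sup => _ [h [[mh h0] hf] <-].
have pa := pos_abse mh.
apply: le_trans (Nc _ pa _); last by move=> lam lam0; exact: hf.
have E t : D t -> kern h t = kern (fun s => `|h s|) t.
  move=> Dt; congr (_ * _).
  apply: (@ae_eq_integral _ _ _ (leb R) _ _ _ (tail_mble t) (tail_Mfun Dt mh) (tail_Mfun Dt pa.1)).
  apply: filterS h0 => s hs /(tail_dom Dt) Ds /=.
  by rewrite gee0_abs ?hs.
rewrite le_eqVlt; apply/orP; left; apply/eqP; apply: (rin_eq X_ri).
- apply: pos_Mplus; have [ma a0] := kern_pos pa; split; last first.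
    by move=> t Dt; rewrite [X in 0 <= X]E ?a0.
  by apply: ae_eq_Mfun ma; apply: aeW => t Dt; rewrite -E.
- exact/pos_Mplus/kern_pos.
- exact: aeW.
Qed.

Lemma le_varrho_abse f : Mfun L f -> N (fun t => `|f t|) <= rho f.
Proof. by move=> mf; apply: le_varrho => //; exact: pos_abse. Qed.

Lemma varrho_le_dist f h : Mfun L f -> pos h ->
  (forall lam, (0 < lam)%R -> dist h lam <= dist (fun t => `|f t|) lam) -> N h <= rho f.
Proof.
move=> mf ph hf; apply: (regular_majorant kern_norm_regular ph (pos_abse mf) hf).
by move=> h' ph' h'f; exact: le_varrho.
Qed.

Lemma varrho_ge0 f : Mfun L f -> 0 <= rho f.
Proof.
move=> mf; apply: le_trans (le_varrho_abse mf); apply: kern_norm_ge0.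
exact: pos_abse.
Qed.

Lemma varrho_mono f g : Mplus L f -> Mplus L g ->
  {ae mu, forall t : lebR R, D t -> f t <= g t} -> rho f <= rho g.
Proof.
move=> [mf f0] [mg g0] fg; apply: varrho_le => h ph hf.
apply: varrho_le_dist => // lam lam0; rewrite hf//; apply: ae_le_dist.
- exact: (pos_abse mf).1.
- exact: (pos_abse mg).1.
apply: filterS3 f0 g0 fg => t f0 g0 fg Dt.
by rewrite !gee0_abs ?f0 ?g0 ?fg.
Qed.

Lemma varrhoD f g : Mfun L f -> Mfun L g -> rho (fun t => f t + g t) <= rho f + rho g.
Proof.
move=> mf mg; apply: varrho_le => h ph hfg.
have [pf pg] := (pos_abse mf, pos_abse mg).
apply: (regular_split kern_norm_regular kern_normD pf pg ph); last 2 first.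
- by move=> h' ph' h'f; exact: le_varrho.
- by move=> h' ph' h'g; exact: le_varrho.
move=> lam lam0; rewrite hfg//; apply: ae_le_dist.
- by apply: (pos_abse _).1; exact: emeasurable_funD.
- exact: (pos_add pf pg).1.
- by apply: aeW => t Dt; exact: lee_abs_add.
Qed.

Lemma varrho_equi f g : equimeasurable L f g -> rho f = rho g.
Proof.
move=> fg; congr ereal_sup; apply/seteqP; split=> _ [h [ph hf] <-]; exists h => //;
split=> // lam lam0; by rewrite hf// fg.
Qed.

Lemma varrho_cvg (f_ : nat -> R -> \bar R) f : (forall k, Mplus L (f_ k)) -> Mplus L f ->
  {ae mu, forall t : lebR R, D t ->
    nondecreasing_seq (f_ ^~ t) /\ f_ ^~ t @ \oo --> f t} ->
  nondecreasing_seq (fun k => rho (f_ k)) /\ rho (f_ k) @[k --> \oo] --> rho f.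
Proof.
move=> pf_ pf cf.
have nd : nondecreasing_seq (fun k => rho (f_ k)).
  by move=> k l kl; apply: varrho_mono => //; apply: filterS cf => t h Dt; apply: (h Dt).1.
split=> //; have := ereal_nondecreasing_cvgn nd; set S := ereal_sup _.
suff -> : S = rho f by [].
have le_f k : {ae mu, forall t : lebR R, D t -> f_ k t <= f t}.
  apply: filterS cf => t h Dt; have [ndt ct] := h Dt.
  have /cvg_unique := ct; move=> /(_ _ _ (ereal_nondecreasing_cvgn ndt)) -> //.
  by apply: ereal_sup_ubound; exists k.
apply/eqP; rewrite eq_le; apply/andP; split.
  by apply: ge_ereal_sup => _ [k _ <-]; exact: varrho_mono.
have f0 : {ae mu, forall t : lebR R, forall k, D t -> 0 <= f_ k t}.
  by apply: ae_foralln => k; exact: (pf_ k).2.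
have [Z [mZ Z0 PZ]] := filterI cf (filterI f0 pf.2).
have {}PZ t : ~ Z t -> D t -> [/\ nondecreasing_seq (f_ ^~ t), f_ ^~ t @ \oo --> f t,
    forall k, 0 <= f_ k t & 0 <= f t].
  move=> nZ Dt; have /contrapT[/(_ Dt)[? ?] [h1 h2]] := contra_not (PZ t) nZ.
  by split=> // [k|]; [exact: h1|exact: h2].
(* Setting everything to 0 on the exceptional null set [Z] makes nonnegativity and monotone
   convergence hold at every point, with the same distribution functions. *)
pose cutoff (g : R -> \bar R) t := if `[< Z t >] then 0 else g t.
have cutoffE g : {ae mu, forall t : lebR R, D t -> g t = cutoff g t}.
  exists Z; split=> // t; apply: contra_notP => nZ /= Dt.
  by rewrite /cutoff; case: asboolP.
have cutoff_pos g : Mfun L g -> (forall t, ~ Z t -> D t -> 0 <= g t) -> pos (cutoff g).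
  move=> mg g0; split; first exact: ae_eq_Mfun (cutoffE g) mg.
  by move=> t Dt; rewrite /cutoff; case: asboolP => // nZ; exact: g0.
have cutoff_dist g lam : Mplus L g -> pos (cutoff g) ->
    dist (cutoff g) lam = dist (fun t => `|g t|) lam.
  move=> [mg g0] pg; apply: ae_eq_dist; [exact: pg.1|exact: (pos_abse mg).1|].
  by apply: filterS2 g0 (cutoffE g) => t h1 h2 Dt; rewrite -h2// gee0_abs ?h1.
have pc_ k : pos (cutoff (f_ k)).
  by apply: cutoff_pos; [exact: (pf_ k).1|move=> t nZ Dt; have [] := PZ t nZ Dt].
have pc : pos (cutoff f).
  by apply: cutoff_pos; [exact: pf.1|move=> t nZ Dt; have [] := PZ t nZ Dt].
apply: varrho_le => h ph hf.
apply: (regular_sup_fatou kern_norm_regular pc_ pc ph) => [t Dt|t Dt|lam lam0|k h' ph' h'f].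
- move=> k l kl; rewrite /cutoff; case: asboolP => // nZ.
  by have [h1 _ _ _] := PZ t nZ Dt; exact: h1.
- rewrite /cutoff; case: asboolP => nZ; first exact: cvg_cst.
  by have [] := PZ t nZ Dt.
- by rewrite cutoff_dist// hf.
apply: (@le_trans _ _ (rho (f_ k))); last by apply: ereal_sup_ubound; exists k.
by apply: le_varrho => // lam lam0; rewrite h'f// cutoff_dist.
Qed.

Lemma leb_itv0 (a : R) : (0 <= a)%R -> mu (itv_oo 0 a%:E) = a%:E.
Proof. by move=> /leb_itv_oo; rewrite subr0. Qed.

Lemma ae_exists (P : R -> Prop) (a : R) : (0 < a)%R ->
  {ae mu, forall t : lebR R, P t} -> exists2 t, (0 < t < a)%R & P t.
Proof.
move=> a0 [Z [mZ Z0 PZ]]; apply: contrapT => H.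
suff : mu (itv_oo 0 a%:E) <= mu Z.
  have a0E : 0 < a%:E by rewrite lte_fin.
  by rewrite (leb_itv0 (ltW a0)) => le; have := lt_le_trans a0E le; rewrite Z0 ltxx.
apply: le_leb => //; first exact: itv_oo_mble.
move=> t /andP[]; rewrite !lte_fin => t0 ta; apply: PZ => /= Pt.
by apply: H; exists t => //; rewrite t0.
Qed.

Lemma kern_norm0 h : pos h -> {ae mu, forall t : lebR R, D t -> h t = 0} -> N h = 0.
Proof.
move=> ph h0; have pk := pos_Mplus (kern_pos ph).
apply/(rin_eq0 X_ri pk); apply: aeW => t Dt.
rewrite /kern (@ae_eq_integral _ _ _ (leb R) _ (cst 0) _ (tail_mble t) (tail_Mfun Dt ph.1)).
- by rewrite integral0 mule0.
- exact: measurable_cst.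
by apply: filterS h0 => s hs /(tail_dom Dt) Ds; rewrite hs// mul0e.
Qed.

Lemma nu_surj s : D s -> exists2 t, D t & nu t = s.
Proof. by move=> Ds; exists (nu_inv L nu s); [exact: nu_inv_dom|exact: nu_invK]. Qed.

Lemma dom_down s t : D t -> (0 < s)%R -> (s <= t)%R -> D s.
Proof.
move=> /andP[_ tL] s0 st; apply/andP; split; rewrite ?lte_fin//.
by apply: le_lt_trans tL; rewrite lee_fin.
Qed.

(** If [rho f = 0], the kernel of [|f|] vanishes at points [t] arbitrarily close to 0, so [f = 0]
    a.e. on their tails; these exhaust the domain because [nu] maps onto it. Conversely, a
    rearrangement of a null function has a support of measure 0. *)
Lemma varrho_eq0 f d : D d -> Mplus L f ->
  rho f = 0 <-> {ae mu, forall t : lebR R, D t -> f t = 0}.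
Proof.
move=> Dd [mf f0]; have pa := pos_abse mf; split=> [rf|f00]; last first.
  apply/eqP; rewrite eq_le varrho_ge0// andbT; apply: varrho_le => h ph hf.
  rewrite kern_norm0//; exists [set t | D t /\ 0 < h t]; split.
  - exact: Mfun_gt ph.1.
  - apply/eqP; rewrite eq_le measure_ge0 andbT -/(dist h 0).
    apply: dist_rcont => [||n]; [exact: ph.1|by []|rewrite add0r hf ?invr_gt0//].
    rewrite (_ : 0 = dist (cst 0) n.+1%:R^-1); last first.
      rewrite /dist (_ : [set _ | _] = set0) ?measure0//.
      by apply/seteqP; split=> // t [_]; rewrite lte_fin ltNge invr_ge0 ler0n.
    apply: ae_le_dist; [exact: pa.1|exact: measurable_cst|].
    by apply: filterS f00 => t ft Dt; rewrite ft// abse0.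
  - move=> t /= /not_implyP[Dt /eqP h0]; split=> //.
    by rewrite lt0e h0 ph.2.
have k0 : {ae mu, forall t : lebR R, D t -> kern (fun s => `|f s|) t = 0}.
  apply/(rin_eq0 X_ri (pos_Mplus (kern_pos pa))); apply/eqP.
  by rewrite eq_le kern_norm_ge0// andbT -rf; exact: le_varrho_abse.
have ex n : exists t, [/\ D t, (t < n.+1%:R^-1)%R & kern (fun s => `|f s|) t = 0].
  have dn0 : (0 < Num.min d n.+1%:R^-1)%R by rewrite lt_min (dom_gt0 Dd) invr_gt0/=.
  have [t /andP[t0]] := ae_exists dn0 k0; rewrite lt_min => /andP[td tn] kt.
  have Dt : D t by apply: dom_down Dd t0 (ltW td).
  by exists t; split=> //; exact: kt.
have {}ex n : exists t, [/\ D t, (t < n.+1%:R^-1)%R &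
    {ae mu, forall s : lebR R, tail t s -> f s = 0}].
  have [t [Dt tn kt]] := ex n; exists t; split=> //.
  have /eqP : kern (fun s => `|f s|) t = 0 := kt.
  rewrite mule_eq0 eqe gt_eqF ?u_gt0//= => /eqP it0.
  have mw := tail_Mfun Dt pa.1.
  have : ae_eq mu (tail t) (fun s => `|f s| * (v s)%:E) (cst 0).
    apply/(ae_eq_integral_abs mu (tail_mble t) mw).
    rewrite -[RHS]it0; apply: eq_integral => s; rewrite inE => ts.
    by rewrite gee0_abs//; exact: (tail_ge0 Dt pa).
  apply: filterS => s + ts => /(_ ts)/eqP.
  have vs := v_gt0 (tail_dom Dt ts).
  by rewrite /= mule_eq0 abse_eq0 eqe (gt_eqF vs) orbF => /eqP.
have [tn tnP] := choice ex.
have : {ae mu, forall s : lebR R, forall n, tail (tn n) s -> f s = 0}.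
  by apply: ae_foralln => n; have [] := tnP n.
apply: filterS => s fs Ds; have [t Dt nut] := nu_surj Ds.
have [n nt] := ltr_add_invr (dom_gt0 Dt); rewrite add0r in nt.
apply: (fs n); have [Dn ltn _] := tnP n; apply/andP; split; last by have /andP[] := Ds.
by rewrite lte_fin -nut nu_lt// (lt_trans ltn).
Qed.

Lemma kern_normZ (c : R) h : pos h -> (0 <= c)%R -> N (fun t => c%:E * h t) = c%:E * N h.
Proof.
move=> ph c0; have pch : pos (fun t => c%:E * h t).
  split; first exact: measurable_funeM ph.1.
  by move=> t Dt; rewrite mule_ge0 ?lee_fin ?ph.2.
have pk := kern_pos ph; rewrite -(rin_homo X_ri)//; last exact: pos_Mplus.
apply: (rin_eq X_ri).
- exact/pos_Mplus/kern_pos.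
- apply: pos_Mplus; split; first exact: measurable_funeM pk.1.
  by move=> t Dt; rewrite mule_ge0 ?lee_fin ?pk.2.
- by apply: aeW => t Dt; exact: kernZ.
Qed.

(** If [h] is a rearrangement of [c f], then [c^-1 h] is one of [f]. The same statement for [c^-1]
    will give the reverse inequality. *)
Let varrhoZ_le (c : R) f : (0 < c)%R -> Mfun L f ->
  rho (fun t => c%:E * f t) <= c%:E * rho f.
Proof.
move=> c0 mf; apply: varrho_le => h ph hf.
have ci0 : (0 < c^-1)%R by rewrite invr_gt0.
pose h' t := c^-1%:E * h t.
have ph' : pos h'.
  split; first exact: measurable_funeM ph.1.
  by move=> t Dt; rewrite mule_ge0 ?lee_fin ?ph.2// ltW.
have -> : N h = c%:E * N h'.
  rewrite -kern_normZ ?ltW//; congr (X (kern _)); apply/funext => t.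
  by rewrite /h' muleA -EFinM divff ?gt_eqF// mul1e.
apply: lee_wpmul2l; first by rewrite lee_fin ltW.
apply: le_varrho => // lam lam0.
transitivity (dist h (c * lam)).
  congr (mu _); apply/seteqP.
  by split=> t /= [Dt]; rewrite /h' lte_pdivlMl ?EFinM.
have E t : ((c * lam)%:E < `|c%:E * f t|) = (lam%:E < `|f t|).
  by rewrite abseM (gee0_abs (_ : 0 <= c%:E)) ?lee_fin ?ltW// EFinM lte_pmul2l.
by rewrite hf ?mulr_gt0//; congr (mu _); apply/seteqP; split=> t /= [Dt]; rewrite E.
Qed.

Lemma varrhoZ d (c : R) f : D d -> (0 <= c)%R -> Mplus L f ->
  rho (fun t => c%:E * f t) = c%:E * rho f.
Proof.
move=> Dd; rewrite le_eqVlt => /predU1P[<- pf|c0 [mf f0]].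
  rewrite mul0e; apply/(varrho_eq0 Dd).
    by split; [exact: measurable_funeM pf.1|apply: aeW => t _; rewrite mul0e].
  by apply: aeW => t _; rewrite mul0e.
apply/eqP; rewrite eq_le varrhoZ_le//=.
rewrite muleC -lee_pdivlMr// muleC.
rewrite {1}(_ : f = fun t => c^-1%:E * (c%:E * f t)).
  by apply: varrhoZ_le; [rewrite invr_gt0|exact: measurable_funeM].
by apply/funext => t; rewrite muleA -EFinM mulVf ?gt_eqF// mul1e.
Qed.

(** Layer-cake formula: an integer [k <= M] is the number of [i < M] with [i < k]. *)
Lemma integral_dyad A n M (r : R -> nat) : mble A -> A `<=` D ->
  (forall k, mble (level L r k)) -> (forall t, (r t <= M)%N) ->
  \int[mu]_(t in A) dyad n (r t) =
  (2 ^- n)%:E * \sum_(k < M) mu (A `&` level L r k).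
Proof.
move=> mA AD mr rM.
have sum_level k : (k <= M)%N -> (\sum_(i < M) (i < k))%N = k.
  move=> kM; rewrite -[RHS]muln1 -[X in (X * _)%N]card_ord -sum_nat_const.
  by rewrite (big_ord_widen _ (fun=> 1%N) kM) [RHS]big_mkcond; apply: eq_bigr => i _; case: ltnP.
have rE t : A t -> dyad n (r t) =
    \sum_(k < M) ((2 ^- n)%:E * (\1_(level L r k) t)%:E) :> \bar R.
  move=> /AD Dt; rewrite /dyad -[X in X%:R](sum_level _ (rM t)) natr_sum mulr_suml -sumEFin.
  apply: eq_bigr => k _; rewrite -EFinM mulrC indicE; congr (_ * _)%:E.
  congr (nat_of_bool _)%:R; apply/idP/idP => [kr|]; first by rewrite inE.
  by rewrite inE => -[].
have mi k : @measurable_fun _ _ (lebR R) _ A (fun t => (\1_(level L r k) t : R)%:E).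
  by apply/measurable_EFinP; exact: (@measurable_indic _ (lebR R)).
have n0 : (0 <= 2 ^- n :> R)%R by rewrite invr_ge0 exprn_ge0.
transitivity (\int[mu]_(t in A) \sum_(k < M) ((2 ^- n)%:E * (\1_(level L r k) t)%:E)).
  by apply: eq_integral => t; rewrite inE => /rE.
rewrite (@ge0_integral_sum _ _ _ (leb R) _ mA); last 2 first.
- by move=> k; exact: measurable_funeM.
- by move=> k t _; rewrite mule_ge0// lee_fin.
rewrite ge0_sume_distrr; last by move=> k _; exact: measure_ge0.
apply: eq_bigr => k _.
rewrite (@ge0_integralZl _ _ _ (leb R) _ mA _ (mi k)); last 2 first.
- by move=> t _; rewrite lee_fin.
- by rewrite lee_fin.
by rewrite (@integral_indic _ _ _ (leb R) _ mA _ (mr k)) setIC.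
Qed.

(** * Local integrals are controlled by [varrho] *)

Definition head (a t : R) : \bar R := (u t * \1_(itv_oo 0 a%:E) t)%:E.

Lemma headE a t : (0 < t < a)%R -> head a t = (u t)%:E.
Proof. by move=> ta; rewrite /head indicE mem_set ?mulr1. Qed.

Lemma head0 a t : (a <= t)%R -> head a t = 0.
Proof.
move=> at_; rewrite /head indicE memNset ?mulr0//.
by move=> /andP[_]; rewrite lte_fin ltNge at_.
Qed.

Lemma mul_indic_pos (A : set R) : mble A -> pos (fun t => (u t * \1_A t)%:E).
Proof.
move=> mA; split; last by move=> t Dt; rewrite lee_fin mulr_ge0// ltW ?u_gt0.
under [X in Mfun _ X]eq_fun do rewrite EFinM.
apply: emeasurable_funM; first exact: u_pos.1.
by apply/measurable_EFinP; exact: (@measurable_indic _ (lebR R)).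
Qed.

Lemma head_pos a : pos (head a).
Proof. exact/mul_indic_pos/itv_oo_mble. Qed.

Section Local.
Variables (b s : R).
Hypotheses (b_gt0 : (0 < b)%R) (s_ge0 : (0 <= s)%R) (Dbs : D (b + s)%R).
Let J : set R := itv_oo b%:E (b + s)%:E.

Let J_dom : J `<=` D.
Proof.
move=> t /andP[]; rewrite !lte_fin => bt tb.
by apply: dom_down Dbs _ _; [exact: lt_trans bt|exact: ltW].
Qed.

Let J_mble : mble J. Proof. exact: itv_oo_mble. Qed.

Let Db : D b. Proof. by apply: dom_down Dbs _ _; rewrite ?lerDl. Qed.

Let J_Mfun h : Mfun L h -> @measurable_fun _ _ (lebR R) _ J h.
Proof. exact: (@measurable_funS _ _ (lebR R) _ D) (@dom_mble R L) J_dom. Qed.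

(** For [t < a] the tail contains [J], because [nu t < nu a = b], and [v] is at least [v (b + s)] on
    [J]; hence the kernel of [h] is at least [i * v (b + s)] times [u] there. *)
Lemma kern_norm_ge a h (i : R) : D a -> nu a = b -> pos h ->
  \int[mu]_(t in J) h t = i%:E -> (i * v (b + s))%:E * X (head a) <= N h.
Proof.
move=> Da nua ph hi; have v0 := v_gt0 Dbs.
have i0 : (0 <= i)%R.
  by rewrite -lee_fin -hi; apply: integral_ge0 => t /J_dom; exact: ph.2.
have pua := head_pos a.
rewrite -(rin_homo X_ri); last 2 first.
- exact: pos_Mplus.
- by rewrite mulr_ge0// ltW.
apply: (rin_mono X_ri).
- apply: pos_Mplus; split; first exact: measurable_funeM pua.1.
  move=> t Dt; apply: mule_ge0; last exact: pua.2.
  by rewrite lee_fin mulr_ge0// ltW.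
- exact/pos_Mplus/kern_pos.
apply: aeW => t Dt; have [ta|at_] := ltP t a; last first.
  by rewrite head0// mule0; exact: (kern_pos ph).2.
rewrite headE ?ta ?(dom_gt0 Dt)// muleC; apply: lee_wpmul2l.
  by rewrite lee_fin ltW ?u_gt0.
have Jt : J `<=` tail t.
  move=> x Jx; have /andP[_ xL] := J_dom Jx; apply/andP; split=> //.
  have /andP[bx _] := Jx; apply: lt_trans bx; rewrite lte_fin -nua.
  by rewrite nu_lt.
apply: le_trans (@ge0_subset_integral _ _ _ (leb R) _ _ J_mble (tail_mble t) _
  (tail_Mfun Dt ph.1) (tail_ge0 Dt ph) Jt).
rewrite mulrC EFinM -hi -(@ge0_integralZl _ _ _ (leb R) _ J_mble _ (J_Mfun ph.1)); last 2 first.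
- by move=> x /J_dom; exact: ph.2.
- by rewrite lee_fin ltW.
apply: (@ge0_le_integral _ _ _ (leb R) _ J_mble).
- by move=> x /J_dom Dx; rewrite mule_ge0 ?ph.2// lee_fin ltW.
- by apply: measurable_funeM; exact: J_Mfun ph.1.
- exact: J_Mfun (weight_pos ph).1.
move=> x Jx; have Dx := J_dom Jx; rewrite muleC; apply: lee_wpmul2l; first exact: ph.2.
by rewrite lee_fin v_le//; have /andP[_] := Jx; rewrite lte_fin => /ltW.
Qed.

(** The boundedness of [h] makes its integral over [J] a real number, as [kern_norm_ge] demands; [C]
    is independent of the bound. *)
Lemma le_kern_norm_local : exists2 C : R, (0 < C)%R & forall h, pos h ->
  (exists M : R, forall t, D t -> h t <= M%:E) ->
  \int[mu]_(t in J) h t <= C%:E * N h.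
Proof.
have [a Da nua] := nu_surj Db; have pua := head_pos a.
have kappa0 : 0 < X (head a).
  rewrite lt0e (rin_ge0 X_ri) ?andbT; last exact: pos_Mplus.
  apply/eqP => /(rin_eq0 X_ri (pos_Mplus pua)) ua0.
  have [t ta] := ae_exists (dom_gt0 Da) ua0.
  have Dt : D t by move: ta => /andP[t0 /ltW]; exact: dom_down.
  by move=> /(_ Dt)/eqP; rewrite headE// eqe gt_eqF ?u_gt0.
(* [X (head a)] may be infinite, so the constant is built from a positive real [k] below it. *)
have [k /andP[k0 kX]] := ge0_ereal_between (lexx 0) kappa0.
rewrite lte_fin in k0; have v0 := v_gt0 Dbs.
exists (v (b + s) * k)^-1%R; first by rewrite invr_gt0 mulr_gt0.
move=> h ph [M hM]; set I := (X in X <= _).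
have I0 : 0 <= I by apply: integral_ge0 => t /J_dom; exact: ph.2.
have Ifin : I \is a fin_num.
  rewrite ge0_fin_numE//; apply: (@le_lt_trans _ _ (\int[mu]_(t in J) M%:E)).
    apply: (@ge0_le_integral _ _ _ (leb R) _ J_mble).
    - by move=> t /J_dom; exact: ph.2.
    - exact: J_Mfun ph.1.
    - exact: measurable_cst.
    - by move=> t /J_dom; exact: hM.
  rewrite (@integral_cst _ _ _ (leb R) _ J_mble) /J leb_itv_oo ?lerDl//.
  by rewrite -EFinM ltry.
have iE : I = (fine I)%:E by rewrite fineK.
rewrite iE lee_pdivlMl ?mulr_gt0//; apply: le_trans (kern_norm_ge Da nua ph iE).
rewrite (_ : _ * (fine I)%:E = (fine I * v (b + s))%:E * k%:E); last first.
  by rewrite -!EFinM mulrC mulrA.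
apply: lee_wpmul2l; last exact: ltW.
by rewrite lee_fin mulr_ge0 ?fine_ge0// ltW.
Qed.

(* The dyadic approximations of [f] on [E] are moved to [(b, b + s)], where [v] is
   bounded away from [0]. *)
Lemma varrho_local (E : set R) : mble E -> E `<=` D -> mu E <= s%:E ->
  exists2 C : R, (0 < C)%R & forall f, Mfun L f ->
    \int[mu]_(t in E) `|f t| <= C%:E * rho f.
Proof.
move=> mE ED Es; have [C C0 NC] := le_kern_norm_local.
exists C => // f mf; have pa := pos_abse mf.
have mE_ g : Mfun L g -> @measurable_fun _ _ (lebR R) _ E g.
  exact: (@measurable_funS _ _ (lebR R) _ D) (@dom_mble R L) ED.
have [m da] := approx_exists pa.
have cm : \int[mu]_(t in E) dyad n (m n t) @[n --> \oo] -->
    \int[mu]_(t in E) (limn (fun n => dyad n (m n t))).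
  apply: (@cvg_monotone_convergence _ _ _ (leb R) _ mE).
  - by move=> n; apply: mE_; exact: (step_pos n (da_step da n)).1.
  - by move=> n t _; exact: dyad_ge0.
  - by move=> t /ED; exact: (da_homo da).
rewrite (_ : \int[mu]_(t in E) `|f t| =
    \int[mu]_(t in E) (limn (fun n => dyad n (m n t)))); last first.
  apply: eq_integral => t; rewrite inE => /ED Dt; apply/esym/cvg_lim => //.
  exact: (da_cvg da).
rewrite -(cvg_lim _ cm)//; apply: lime_le; first by apply/cvg_ex; eexists; exact: cm.
apply: nearW => n; have sm := da_step da n.
have [M mM] := step_bounded sm.
pose c k := mu (E `&` level L (m n) k).
have mEl k : mble (E `&` level L (m n) k) by apply: measurableI => //; exact: step_mble.
have cs k : c k <= s%:E.
  by apply: le_trans Es; apply: le_leb => //; exact: subIsetl.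
have cfin k : c k \is a fin_num.
  by rewrite ge0_fin_numE ?measure_ge0//; apply: le_lt_trans (cs k) (ltry _).
have dc k l : (k <= l)%N -> c l <= c k.
  by move=> kl; apply: le_leb => //; apply: setIS; exact: le_level.
(* Stacking along [t - b] turns the level [k] of [m n] on [E] into the interval from [b] to
   [b + c k], which fits into [J] because [mu E <= s]. The value [+oo] makes [q] vanish outside
   [J]. *)
pose sigma t : \bar R := if `[< J t >] then (t - b)%:E else +oo.
pose q t := stack M c (sigma t).
have c0 k : (M <= k)%N -> c k = 0.
  move=> Mk; rewrite /c (_ : _ `&` _ = set0) ?measure0//.
  by apply/seteqP; split=> // t [_ [_ /leq_trans/(_ (mM t))]]; rewrite ltnNge Mk.
have qlevel k : level L q k = itv_oo b%:E (b + fine (c k))%:E.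
  apply/seteqP; split=> t.
    move=> [Dt]; rewrite /q ltn_stack// => /andP[_]; rewrite /sigma.
    case: asboolP => [/andP[bt _]|_]; last by rewrite ltNge leey.
    by rewrite -(fineK (cfin k)) lte_fin ltrBlDl => tb; apply/andP; split.
  move=> /andP[]; rewrite !lte_fin => bt tc.
  have Jt : J t.
    apply/andP; rewrite !lte_fin; split=> //; apply: lt_le_trans tc _.
    by rewrite lerD2l -lee_fin fineK.
  split; first exact: J_dom.
  rewrite /q ltn_stack//; apply/andP; split; last first.
    by rewrite /sigma; case: asboolP => // _; rewrite -(fineK (cfin k)) lte_fin ltrBlDl.
  rewrite ltnNge; apply/negP => Mk; move: tc; rewrite c0//= addr0.
  by rewrite ltNge ltW.
have mq k : mble (level L q k) by rewrite qlevel; exact: itv_oo_mble.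
have qM t : (q t <= M)%N by rewrite leqNgt; apply/negP; rewrite /q ltn_stack// ltnn.
have c_ge0 k : (0 <= fine (c k))%R by rewrite fine_ge0// measure_ge0.
have leb_q k : mu (level L q k) = c k.
  by rewrite qlevel leb_itv_oo ?lerDl// addrAC subrr add0r fineK.
have JE k : J `&` level L q k = level L q k.
  apply/setIidPr => t; rewrite qlevel => /andP[bt]; rewrite lte_fin => tc.
  apply/andP; split=> //; rewrite lte_fin (lt_le_trans tc)// lerD2l.
  by rewrite -lee_fin fineK.
have -> : \int[mu]_(t in E) dyad n (m n t) = \int[mu]_(t in J) dyad n (q t) :> \bar R.
  rewrite (integral_dyad _ mE ED (step_mble sm) mM) (integral_dyad _ J_mble J_dom mq qM).
  by congr (_ * _); apply: eq_bigr => k _; rewrite JE leb_q.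
have phi0 : dyad n 0 = 0 :> \bar R by rewrite /dyad mul0r.
have phi_ge0 k : (0 : \bar R) <= dyad n k by exact: dyad_ge0.
(* [m1] is [m n] cut to [E]. It has the law of [q] and lies below the approximation of [|f|], so the
   distribution of [q] is below that of [|f|]. *)
pose m1 t := if `[< E t >] then m n t else 0%N.
have m1level k : level L m1 k = E `&` level L (m n) k.
  apply/seteqP; split=> t; rewrite /level /m1/=.
    by move=> [Dt]; case: asboolP.
  by move=> [Et [Dt km]]; case: asboolP.
have sm1 : step L m1.
  split; [by move=> k; rewrite m1level|rewrite m1level|exists M => t].
    by apply: le_lt_trans (cs 0%N) (ltry _).
  by rewrite /m1; case: asboolP.
have law k : mu (level L m1 k) = mu (level L q k) by rewrite m1level leb_q.
have m1M t : (m1 t <= M)%N by rewrite /m1; case: asboolP.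
have pq := same_law_pos mq qM phi0 phi_ge0.
apply: le_trans (NC _ pq _) _.
  by exists (M%:R / 2 ^+ n)%R => t Dt; rewrite le_dyad.
apply: lee_wpmul2l; first by rewrite lee_fin ltW.
apply: varrho_le_dist => // lam lam0.
rewrite -(same_law_dist sm1 mq law m1M qM phi0 (ltW lam0)).
apply: le_leb.
- exact: Mfun_gt (step_pos n sm1).1.
- exact: Mfun_gt pa.1.
move=> t [Dt lt]; split=> //; apply: lt_le_trans lt (le_trans _ (da_le da Dt n)).
by rewrite le_dyad /m1; case: asboolP.
Qed.

End Local.

Hypothesis L_gt0 : 0 < L.

Lemma dom_pt : exists d, D d.
Proof. by have [d] := ge0_ereal_between (lexx 0) L_gt0; exists d. Qed.

(** For [L] finite, [E] may fill the domain, leaving no interval of length [mu E] away from the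
    endpoints. It is cut at the midpoint, and each half is moved to [(l/4, 3l/4)]. For [L] infinite,
    the interval of length [mu E] starting at 1 serves. *)
Lemma varrho_loc (E : set R) : mble E -> E `<=` D -> mu E < +oo ->
  exists2 C : R, (0 < C)%R & forall f, Mplus L f ->
    \int[mu]_(t in E) f t <= C%:E * rho f.
Proof.
move=> mE ED Eoo.
suff [C C0 HC] : exists2 C : R, (0 < C)%R & forall f, Mfun L f ->
    \int[mu]_(t in E) `|f t| <= C%:E * rho f.
  exists C => // f [mf f0]; apply: le_trans (HC _ mf).
  rewrite (@ae_eq_integral _ _ _ (leb R) E (fun t => `|f t|) f mE); first exact: lexx.
  - exact: (@measurable_funS _ _ (lebR R) _ D) (@dom_mble R L) ED mf.
  - exact: (@measurable_funS _ _ (lebR R) _ D) (@dom_mble R L) ED (pos_abse mf).1.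
  - by apply: filterS f0 => t ft /ED Dt; rewrite gee0_abs ?ft.
have Efin : mu E \is a fin_num by rewrite ge0_fin_numE.
have [Lfin|Linf] := boolP (L \is a fin_num); last first.
  have Loo : L = +oo by move: Linf L_gt0; case: L.
  apply: (@varrho_local 1 (fine (mu E))) => //; rewrite ?fine_ge0 ?fineK//.
  apply/andP; split; last by rewrite Loo ltry.
  by rewrite lte_fin ltr_pwDl// fine_ge0.
pose l := fine L; have Ll : L = l%:E by rewrite fineK.
have l0 : (0 < l)%R by rewrite -lte_fin -Ll.
pose E1 := E `&` itv_oo 0 (l / 2)%:E; pose E2 := E `\` E1.
have mE1 : mble E1 by apply: measurableI => //; exact: itv_oo_mble.
have mE2 : mble E2 by exact: measurableD.
have E1D : E1 `<=` D by move=> t [/ED].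
have E2D : E2 `<=` D by move=> t [/ED].
have l2 : (0 <= l / 2)%R by rewrite divr_ge0// ltW.
have Dq : D (l / 4 + l / 2)%R by apply/andP; rewrite Ll !lte_fin; split; lra.
have l4 : (0 < l / 4)%R by rewrite divr_gt0.
have [|C1 C10 H1] := @varrho_local (l / 4) (l / 2) l4 l2 Dq E1 mE1 E1D.
  rewrite -(leb_itv0 l2); apply: le_leb => //; [exact: itv_oo_mble|exact: subIsetr].
have [|C2 C20 H2] := @varrho_local (l / 4) (l / 2) l4 l2 Dq E2 mE2 E2D.
  apply: (@le_trans _ _ (mu [set` `[(l / 2)%R, l[])).
    apply: le_leb => //; first by apply: lebesgue_mble; exact: measurable_itv.
    move=> t [Et nt]; rewrite /= in_itv/=; have /andP[t0 tL] := ED t Et.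
    rewrite -lte_fin -Ll tL andbT leNgt; apply/negP => tl; apply: nt; split=> //.
    by apply/andP; split.
  rewrite leb_itv lebesgue_measure_itv/= lte_fin; case: ltP => _; last by rewrite lee_fin.
  by rewrite -EFinB lee_fin; lra.
exists (C1 + C2)%R; first by rewrite addr_gt0.
move=> f mf; have r0 := varrho_ge0 mf.
rewrite EFinD ge0_muleDl; [|by rewrite lee_fin ltW..].
have E12 : E = E1 `|` E2 by rewrite /E2 setDUK//; exact: subIsetl.
rewrite {1}E12 (@ge0_integral_setU _ _ _ (leb R) _ _ mE1 mE2).
- by apply: leeD; [exact: H1|exact: H2].
- apply: (@measurable_funS _ _ (lebR R) _ D) (@dom_mble R L) _ (pos_abse mf).1.
  by rewrite -E12.
- by move=> t _.
- by rewrite disj_set2E; apply/eqP/seteqP; split=> // t [? []].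
Qed.

(** Condition (A) enters through the finiteness on indicators alone. *)
Lemma varrho_ri :
  (forall E : set R, mble E -> E `<=` D -> mu E < +oo -> rho (fun t => (\1_E t)%:E) < +oo) ->
  is_ri_norm L rho.
Proof.
move=> rfin; have [d Dd] := dom_pt; split => //.
- by move=> f [mf _]; exact: varrho_ge0.
- by move=> f pf; exact: varrho_eq0 Dd pf.
- by move=> f c pf c0; exact: (varrhoZ Dd).
- by move=> f g [mf _] [mg _]; exact: varrhoD.
- exact: varrho_mono.
- exact: varrho_cvg.
- exact: varrho_loc.
- by move=> f g _ _; exact: varrho_equi.
Qed.

(** * Indicators and condition (A) *)

Definition ind (A : set R) (t : R) : \bar R := (\1_A t)%:E.

Lemma ind_pos A : mble A -> pos (ind A).
Proof.
move=> mA; split; last by move=> t Dt; rewrite lee_fin.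
by apply/measurable_EFinP; exact: (@measurable_indic _ (lebR R)).
Qed.

Lemma indE (A : set R) t : A t -> ind A t = 1.
Proof. by move=> At; rewrite /ind indicE mem_set. Qed.

Lemma ind0 (A : set R) t : ~ A t -> ind A t = 0.
Proof. by move=> At; rewrite /ind indicE memNset. Qed.

Lemma le_ind (A B : set R) t : A `<=` B -> ind A t <= ind B t.
Proof.
move=> AB; have [At|nA] := pselect (A t); first by rewrite !indE//; exact: AB.
by rewrite ind0// lee_fin.
Qed.

Lemma kern_ind A t : mble A -> D t ->
  kern (ind A) t = (u t)%:E * \int[mu]_(s in tail t `&` A) (v s)%:E.
Proof.
move=> mA Dt; congr (_ * _); rewrite integral_mkcondr; apply: eq_integral => s _.
rewrite patchE; have [At|nA] := pselect (A s).
  by rewrite indE// mul1e mem_set.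
by rewrite ind0// mul0e memNset.
Qed.

(** [F] is the support of [h]. Right continuity at level 0 bounds its measure, and [h <= 1] a.e.
    because the distribution function of an indicator vanishes at 1. *)
Lemma equi_ind (E : set R) h : mble E -> E `<=` D -> pos h ->
  (forall lam, (0 < lam)%R -> dist h lam = dist (fun t => `|(\1_E t)%:E|) lam) ->
  exists F, [/\ mble F, F `<=` D, mu F <= mu E &
    {ae mu, forall t : lebR R, D t -> h t <= ind F t}].
Proof.
move=> mE ED ph hE; exists [set t | D t /\ 0 < h t].
have absE t : `|(\1_E t)%:E| = ind E t :> \bar R by rewrite gee0_abs// lee_fin.
split; first exact: Mfun_gt ph.1.
- by move=> t [].
- rewrite -/(dist h 0); apply: dist_rcont => [||n]; [exact: ph.1|by []|].
  rewrite add0r hE ?invr_gt0//; apply: le_leb => //.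
    apply: Mfun_gt; apply: (pos_abse _).1; exact: (ind_pos mE).1.
  move=> t [Dt]; rewrite absE; have [//|nE] := pselect (E t).
  by rewrite ind0// lte_fin ltNge invr_ge0 ler0n.
- exists [set t | D t /\ 1 < h t]; split; first exact: Mfun_gt ph.1.
    rewrite -/(dist h 1) hE// /dist (_ : [set _ | _] = set0) ?measure0//.
    apply/seteqP; split=> // t [_]; rewrite absE; have [Et|nE] := pselect (E t).
      by rewrite indE// ltxx.
    by rewrite ind0// lte_fin ltr10.
  move=> t /= /not_implyP[Dt /negP]; rewrite -ltNge => ht; split=> //.
  apply: (le_lt_trans _ ht); rewrite indE//; split=> //.
  by apply: le_lt_trans ht; rewrite lee_fin.
Qed.

Lemma ext_normE f : pos f -> ext_norm X f = X f.
Proof.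
move=> pf; apply: (rin_eq X_ri); [exact/pos_Mplus/pos_abse/pf.1|exact: pos_Mplus|].
by apply: aeW => t Dt; rewrite gee0_abs ?pf.2.
Qed.

Lemma in_spaceE f g : pos g -> (forall t, D t -> f t = g t) ->
  in_space L X f <-> X g < +oo.
Proof.
move=> pg fg; have mf : Mfun L f by apply: ae_eq_Mfun pg.1; apply: aeW => t Dt; rewrite fg.
have -> : X g = ext_norm X f.
  rewrite -(ext_normE pg); apply: (rin_eq X_ri).
  - exact/pos_Mplus/pos_abse/pg.1.
  - exact/pos_Mplus/pos_abse.
  - by apply: aeW => t Dt; rewrite fg.
by split=> [[]//|].
Qed.

Lemma condA_finE : condA_fin L u v nu X <-> N (ind D) < +oo.
Proof.
apply: in_spaceE; first exact/kern_pos/ind_pos/dom_mble.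
move=> t Dt; rewrite kern_ind//; last exact: dom_mble.
by rewrite setIidl//; exact: tail_dom.
Qed.

(** Every rearrangement of an indicator lies a.e. below [ind D], whose kernel is the function in
    (A). *)
Lemma condA_fin_varrho (E : set R) : condA_fin L u v nu X ->
  mble E -> E `<=` D -> rho (fun t => (\1_E t)%:E) < +oo.
Proof.
move=> /condA_finE A mE ED; apply: le_lt_trans A.
apply: varrho_le => h ph /(equi_ind mE ED ph)[F [mF FD _ hF]].
apply: (regular_mono kern_norm_regular ph (ind_pos (@dom_mble R L))).
by apply: filterS hF => t hF Dt; apply: le_trans (hF Dt) _; exact: le_ind.
Qed.

(** * Bounded operators and optimality *)

Lemma bounded_kern_norm Z : is_ri_norm L Z -> bounded_op L (H_op L u v nu) Z X ->
  exists2 C : R, (0 < C)%R & forall f, pos f -> N f <= C%:E * Z f.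
Proof.
(* [bounded_op] allows any real constant; the maximum with 1 supplies the positive one that [embeds]
   requires. *)
move=> Z_ri [C HC]; exists (Num.max C 1%R); first by rewrite lt_max ltr01 orbT.
move=> f pf; have pa := pos_abse pf.1.
have E1 : ext_norm Z f = Z f.
  apply: (rin_eq Z_ri); [exact: pos_Mplus|exact: pos_Mplus|].
  by apply: aeW => t Dt; rewrite gee0_abs ?pf.2.
have E2 t : D t -> H_op L u v nu f t = kern f t.
  move=> Dt; congr (_ * _); apply: eq_integral => s; rewrite inE => /(tail_dom Dt) Ds.
  by rewrite gee0_abs ?pf.2.
have pk := kern_pos pf.
have mH : Mfun L (H_op L u v nu f).
  by apply: ae_eq_Mfun pk.1; apply: aeW => t Dt; rewrite E2.
have -> : N f = ext_norm X (H_op L u v nu f).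
  rewrite /kern_norm -(ext_normE pk); apply: (rin_eq X_ri).
  - exact/pos_Mplus/pos_abse/pk.1.
  - exact/pos_Mplus/pos_abse.
  - by apply: aeW => t Dt; rewrite E2.
apply: le_trans (HC _ pf.1) _; rewrite E1; apply: lee_wpmul2r.
  by apply: (rin_ge0 Z_ri); exact: pos_Mplus.
by rewrite lee_fin le_max lexx.
Qed.

Lemma bounded_kern_norm_ind Z A : is_ri_norm L Z ->
  bounded_op L (H_op L u v nu) Z X -> mble A -> A `<=` D -> mu A < +oo ->
  N (ind A) < +oo.
Proof.
move=> Z_ri /(bounded_kern_norm Z_ri)[C C0 NZ] mA AD Aoo.
apply: le_lt_trans (NZ _ (ind_pos mA)) _.
by apply: lte_mul_pinfty; rewrite ?lee_fin ?ltW//; exact: (rin_fin Z_ri).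
Qed.

Lemma varrho_bounded : bounded_op L (H_op L u v nu) rho X.
Proof.
exists 1%R => f mf; rewrite mul1e; have pa := pos_abse mf.
have pk := kern_pos pa; rewrite -[H_op _ _ _ _ _]/(kern (fun s => `|f s|)) ext_normE//.
by apply: le_varrho => // lam lam0; apply/esym; exact: dist_abse.
Qed.

(** [Z] takes the same value on all rearrangements of [f], so one bound for the operator on [Z]
    serves the whole supremum. *)
Lemma varrho_optimal Z : is_ri_norm L Z -> bounded_op L (H_op L u v nu) Z X ->
  embeds L Z rho.
Proof.
move=> Z_ri /(bounded_kern_norm Z_ri)[C C0 NZ]; exists C => // f mf.
have pa := pos_abse mf.
apply: varrho_le => h ph hf; apply: le_trans (NZ _ ph) _.
apply: lee_wpmul2l; first by rewrite lee_fin ltW.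
apply: (rin_le_dist Z_ri ph pa) => lam lam0.
by rewrite hf// dist_abse.
Qed.

(** * The half-line *)

Section Infinite.
Hypotheses (Loo : L = +oo) (nu_D : underD_infty nu).

Let dom_pos (t : R) : (0 < t)%R -> D t.
Proof. by move=> t0; apply/andP; rewrite Loo lte_fin ltry. Qed.

Let nu_inv_gt0 (t : R) : (0 < t)%R -> (0 < nu_inv L nu t)%R.
Proof. by move=> /dom_pos/nu_inv_dom/dom_gt0. Qed.

(** * Norms of [u] cut to an initial interval *)

Lemma le_head a b : (a <= b)%R -> X (head a) <= X (head b).
Proof.
move=> ab; apply: (rin_mono X_ri); [exact/pos_Mplus/head_pos..|].
apply: aeW => t Dt; rewrite lee_fin ler_pM2l ?u_gt0// -lee_fin.
apply: le_ind => s /andP[s0 sa]; apply/andP; split=> //.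
by apply: lt_le_trans sa _; rewrite lee_fin.
Qed.

(** The piece of [u] on [[a, 2a)] has a smaller distribution than the piece on [(0, a)]: if [u]
    exceeds [lam] somewhere beyond [a], it does so on all of [(0, a)], which has the same length. *)
Lemma head_double a : (0 < a)%R -> X (head (2 * a)) <= 2%:E * X (head a).
Proof.
move=> a0; have m2 : mble [set` `[a, (2 * a)%R[].
  by apply: lebesgue_mble; exact: measurable_itv.
pose r t := (u t * \1_[set` `[a, (2 * a)%R[] t)%:E.
have pr : pos r by exact: mul_indic_pos.
have pa := head_pos a.
have ra : X r <= X (head a).
  apply: (rin_le_dist X_ri pr pa) => lam lam0.
  have [[t0 [Dt0 rt0]]|/forallNP H] := pselect (exists t, D t /\ lam%:E < r t); last first.
    rewrite /dist (_ : [set t | D t /\ lam%:E < r t] = set0) ?measure0//.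
    by apply/seteqP; split=> // t; exact: H.
  have [t0J|nJ] := pselect ([set` `[a, (2 * a)%R[] t0); last first.
    by move: rt0; rewrite /r indicE memNset// mulr0 lte_fin ltNge ltW.
  move: rt0; rewrite /r indicE mem_set// mulr1 lte_fin => ut0.
  move: t0J; rewrite /= in_itv/= => /andP[at0 _].
  apply: (@le_trans _ _ (mu [set` `[a, (2 * a)%R[])).
    apply: le_leb => //; first exact: Mfun_gt pr.1.
    move=> t [Dt rt]; apply: contrapT => nJ; move: rt.
    by rewrite /r indicE memNset// mulr0 lte_fin ltNge ltW.
  rewrite leb_itv lebesgue_measure_itv/= lte_fin ltr_pMl// ltr1n.
  rewrite -EFinB mulr_natl mulr2n addrK -(leb_itv0 (ltW a0)).
  apply: le_leb; [exact: itv_oo_mble|exact: Mfun_gt pa.1|].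
  move=> t /andP[]; rewrite !lte_fin => t_gt0 ta; have Dt := dom_pos t_gt0.
  split=> //; rewrite headE ?t_gt0// lte_fin; apply: lt_le_trans ut0 _.
  by apply: u_le => //; apply: ltW; exact: lt_le_trans at0.
apply: (@le_trans _ _ (X (head a) + X r)).
  apply: le_trans (rin_triangle X_ri (pos_Mplus pa) (pos_Mplus pr)).
  apply: (rin_mono X_ri); [exact/pos_Mplus/head_pos|exact/pos_Mplus/pos_add|].
  apply: aeW => t Dt; rewrite -EFinD lee_fin -mulrDr ler_pM2l ?u_gt0//.
  rewrite !indicE; have [t2|t2] := ltP t (2 * a)%R; last first.
    rewrite memNset ?addr_ge0// => /andP[_]; rewrite lte_fin.
    by rewrite ltNge t2.
  rewrite mem_set; last by apply/andP; rewrite !lte_fin (dom_gt0 Dt).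
  have [ta|at_] := ltP t a.
    by rewrite mem_set ?lerDl//; apply/andP; rewrite !lte_fin (dom_gt0 Dt).
  by rewrite addrC mem_set ?lerDl//= in_itv/= at_.
rewrite -[2%R]/(2%:R)%R mule_natl mule2n; exact: leeD.
Qed.

Lemma head_pow2 k a : (0 < a)%R -> X (head (2 ^+ k * a)) <= (2 ^+ k)%:E * X (head a).
Proof.
move=> a0; elim: k => [|k IH]; first by rewrite !expr0 mul1r mul1e.
rewrite exprS -mulrA; apply: le_trans (head_double _) _.
  by rewrite mulr_gt0// exprn_gt0.
by rewrite EFinM -muleA; apply: lee_wpmul2l; rewrite ?lee_fin.
Qed.

Lemma nu_growth : exists theta eps T : R, [/\ (1 < theta)%R, (0 < eps)%R &
  forall t, (T < t)%R -> (1 + eps <= nu (theta * t) / nu t)%R].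
Proof.
have [theta theta1] := nu_D; rewrite /limf_einf lteNr limf_esupE.
move=> /ereal_inf_lt[_ [A [T [_ TA]] <-]]; set S := ereal_sup _ => S1.
exists theta.
have AS t : (T < t)%R -> - (nu (theta * t) / nu t)%:E <= S.
  by move=> /TA At; apply: ereal_sup_ubound; exists t.
have TT : (T < T + 1)%R by rewrite ltrDl.
move: S1 AS; case: S => [s| |]//; last first.
  by move=> _ /(_ _ TT); rewrite -EFinN leeNy_eq.
(* [s] bounds the negated ratio from above, so [1 + eps = - s]. *)
rewrite -EFinN lte_fin => s1 AS; exists (- s - 1)%R, T; split=> //; first by lra.
by move=> t /AS; rewrite -EFinN lee_fin => ?; lra.
Qed.

(** With [a = nu^-1 tau], growth gives [nu (theta * a) >= (1 + eps) * tau >= tau + 1] once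
    [tau >= 1/eps]. Hence [nu^-1 (tau + 1) <= theta * a <= 2^k * a], and [k] doublings suffice. The
    bound [nu t1 <= tau] places [a] beyond the threshold [T]. *)
Lemma head_shift : exists C tau1 : R, (0 <= C)%R /\ forall tau, (tau1 <= tau)%R ->
  X (head (nu_inv L nu (tau + 1))) <= C%:E * X (head (nu_inv L nu tau)).
Proof.
have [theta [eps [T [theta1 eps0 Tnu]]]] := nu_growth.
pose k := (Num.truncn theta).+1.
have thetak : (theta <= 2 ^+ k)%R.
  apply: le_trans (ltW (truncnS_gt theta)) _.
  by rewrite -natrX ler_nat ltnW// ltn_expl.
pose t1 : R := (`|T| + 1)%R; have t10 : (0 < t1)%R by rewrite ltr_wpDl.
exists (2 ^+ k)%R, (Num.max (nu t1) eps^-1)%R; split; first exact: exprn_ge0.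
move=> tau; rewrite ge_max => /andP[nut1 etau].
have tau0 : (0 < tau)%R by apply: lt_le_trans etau; rewrite invr_gt0.
set a := nu_inv L nu tau.
have a0 : (0 < a)%R by exact: nu_inv_gt0.
have nua : nu a = tau by apply: nu_invK; exact: dom_pos.
have t1a : (t1 <= a)%R.
  rewrite leNgt; apply/negP => at1; move: nut1; rewrite -nua leNgt.
  by rewrite nu_lt ?at1//; exact: dom_pos.
have Ta : (T < a)%R.
  by apply: lt_le_trans t1a; rewrite /t1 (le_lt_trans (ler_norm T))// ltrDl.
have := Tnu _ Ta; rewrite nua ler_pdivlMr// => nuta.
have ta0 : (0 < theta * a)%R by rewrite mulr_gt0// (lt_trans _ theta1).
have le1 : (tau + 1 <= nu (theta * a))%R.
  apply: le_trans nuta; rewrite mulrDl mul1r lerD2l.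
  by rewrite mulrC -ler_pdivrMr// div1r.
have le2 : (nu_inv L nu (tau + 1) <= 2 ^+ k * a)%R.
  apply: (@le_trans _ _ (theta * a)%R); last by rewrite ler_pM2r.
  have tau10 : (0 < tau + 1)%R by rewrite addr_gt0.
  rewrite leNgt; apply/negP => lt; move: le1; rewrite leNgt.
  rewrite -{1}(nu_invK (dom_pos tau10)) nu_lt ?lt//; first exact: dom_pos.
  exact/dom_pos/nu_inv_gt0.
exact: le_trans (le_head le2) (head_pow2 k a0).
Qed.

(** * Condition (A) at the origin and at infinity *)

Lemma kern_norm_unit : N (ind (itv_oo 0 1)) < +oo <->
  in_space L X (fun t => (u t)%:E * (\1_(itv_oo 0 (nu_inv L nu 1)%:E) t)%:E *
    \int[leb R]_(s in itv_oo (nu t)%:E 1) (v s)%:E).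
Proof.
apply: iff_sym; apply: in_spaceE; first exact/kern_pos/ind_pos/itv_oo_mble.
move=> t Dt; rewrite kern_ind//; last exact: itv_oo_mble.
have nut := dom_gt0 (nu_dom Dt); have D1 := dom_pos (@ltr01 R).
have -> : tail t `&` itv_oo 0 1 = itv_oo (nu t)%:E 1.
  apply/seteqP; split=> s.
    by move=> [/andP[ns _] /andP[_ s1]]; apply/andP.
  move=> /andP[ns s1]; split; apply/andP; split=> //; first by rewrite Loo ltry.
  by apply: lt_trans ns; rewrite lte_fin.
have [t1|t1] := ltP t (nu_inv L nu 1).
  have /indE E1 : itv_oo 0 (nu_inv L nu 1)%:E t.
    by apply/andP; rewrite !lte_fin (dom_gt0 Dt).
  by rewrite -[(\1_(itv_oo 0 _) t)%:E]/(ind _ t) E1 mule1.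
rewrite (_ : itv_oo (nu t)%:E 1 = set0) ?integral_set0 ?mule0//.
apply/seteqP; split=> // s /andP[ns s1]; have := lt_trans ns s1.
rewrite lte_fin -{1}(nu_invK D1) nu_lt// ?ltNge ?t1//; exact: nu_inv_dom.
Qed.

Lemma condA_limsup : limf_esup (fun tau : R => (v tau)%:E *
    ext_norm X (fun t => (u t * \1_(itv_oo 0 (nu_inv L nu tau)%:E) t)%:E)) +oo%R < +oo <->
  exists K T : R, forall tau, (T < tau)%R ->
    (v tau)%:E * X (head (nu_inv L nu tau)) <= K%:E.
Proof.
split; last first.
  move=> [K [T HK]]; rewrite limf_esupE; apply: le_lt_trans (ltry K).
  apply: (@le_trans _ _ (ereal_sup ((fun tau : R => (v tau)%:E *
    ext_norm X (head (nu_inv L nu tau))) @` [set tau | (T < tau)%R]))).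
    apply: ereal_inf_lbound; exists [set tau | (T < tau)%R] => //.
    by exists T; split; [exact: num_real|].
  apply: ge_ereal_sup => _ [tau Ttau <-]; rewrite ext_normE; first exact: HK.
  exact: head_pos.
rewrite limf_esupE => /ereal_inf_lt[_ [A [T [_ TA]] <-]]; set S := ereal_sup _ => Soo.
have [K SK] : exists K : R, S <= K%:E.
  by case: S Soo => [s _|//|_]; [exists s|exists 0%R; rewrite leNye].
exists K, T => tau /TA At; apply: le_trans SK; rewrite -(ext_normE (head_pos _)).
by apply: ereal_sup_ubound; exists tau.
Qed.

(** For [t] beyond [nu^-1 be] the tail misses [A]; before it, [v <= v al] on [A], so the integral is
    at most [v al * mu A]. *)
Lemma kern_norm_piece (al be : R) A : (0 < al)%R -> (al <= be)%R -> mble A ->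
  A `<=` [set` `[al, be[] ->
  N (ind A) <= (v al)%:E * X (head (nu_inv L nu be)) * mu A.
Proof.
move=> al0 ab mA Aab; have be0 : (0 < be)%R by exact: lt_le_trans ab.
have ph := head_pos (nu_inv L nu be).
have AD : A `<=` D.
  by move=> t /Aab/=; rewrite in_itv/= => /andP[+ _] => /(lt_le_trans al0)/dom_pos.
have Afin : mu A \is a fin_num.
  rewrite ge0_fin_numE ?measure_ge0//.
  apply: (@le_lt_trans _ _ (mu [set` `[al, be[])).
    by apply: le_leb => //; apply: lebesgue_mble; exact: measurable_itv.
  by rewrite leb_itv lebesgue_measure_itv/=; case: ifP; rewrite -?EFinB ltry.
have val0 := v_gt0 (dom_pos al0).
have c0 : (0 <= v al * fine (mu A))%R by rewrite mulr_ge0 ?fine_ge0 ?measure_ge0// ltW.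
rewrite muleAC -{1}(fineK Afin) -EFinM -(rin_homo X_ri)//; last exact: pos_Mplus.
apply: (rin_mono X_ri).
- exact/pos_Mplus/kern_pos/ind_pos.
- apply: pos_Mplus; split; first exact: measurable_funeM ph.1.
  by move=> t Dt; apply: mule_ge0; [rewrite lee_fin|exact: ph.2].
apply: aeW => t Dt; rewrite kern_ind//.
have mtA : mble (tail t `&` A) by exact: measurableI.
have [tb|bt] := ltP t (nu_inv L nu be); last first.
  rewrite (_ : tail t `&` A = set0); last first.
    apply/seteqP; split=> // s [/andP[ns _] /Aab/=]; rewrite in_itv/= => /andP[_].
    rewrite ltNge => /negP; apply; move: ns; rewrite lte_fin => /ltW; apply: le_trans.
    by rewrite -{1}(nu_invK (dom_pos be0)) nu_le//; exact/nu_inv_dom/dom_pos.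
  by rewrite integral_set0 mule0; apply: mule_ge0; [rewrite lee_fin|exact: ph.2].
rewrite headE ?tb ?(dom_gt0 Dt)// [leRHS]muleC; apply: lee_wpmul2l.
  by rewrite lee_fin ltW ?u_gt0.
apply: (@le_trans _ _ (\int[mu]_(s in tail t `&` A) (v al)%:E)).
  apply: (@ge0_le_integral _ _ _ (leb R) _ mtA).
  - by move=> s [_ /AD Ds]; rewrite lee_fin ltW ?v_gt0.
  - apply: (@measurable_funS _ _ (lebR R) _ D) (@dom_mble R L) _ v_Mfun.
    by move=> s [_ /AD].
  - exact: measurable_cst.
  - move=> s [_ As]; rewrite lee_fin v_le//; [exact: dom_pos|exact: AD|].
    by move: (Aab _ As); rewrite /= in_itv/= => /andP[].
rewrite (@integral_cst _ _ _ (leb R) _ mtA) EFinM fineK//.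
apply: lee_wpmul2l; first by rewrite lee_fin ltW.
by apply: le_leb => //; exact: subIsetr.
Qed.

(** A piece between consecutive integers pairs [v] at its left end with [head] at its right end;
    [head_shift] absorbs the gap for large [n]. The finitely many other [n] are bounded by
    monotonicity, [X (head (nu_inv L nu n0.+1%:R))] being finite by the large case at [n0]. *)
Lemma condA_inf_bound K T :
  (forall tau, (T < tau)%R -> (v tau)%:E * X (head (nu_inv L nu tau)) <= K%:E) ->
  exists2 M : R, (0 <= M)%R & forall n,
    (v n.+1%:R)%:E * X (head (nu_inv L nu n.+2%:R)) <= M%:E.
Proof.
move=> HK; have [C [tau1 [C0 HC]]] := head_shift.
pose n0 := (Num.truncn (Num.max T tau1)).+1.
have n0T : (T < n0%:R)%R by apply: le_lt_trans (truncnS_gt _); rewrite le_max lexx.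
have n0tau : (tau1 <= n0%:R)%R.
  by apply/ltW; apply: le_lt_trans (truncnS_gt _); rewrite le_max lexx orbT.
have X0 a : 0 <= X (head a) by apply: (rin_ge0 X_ri); exact/pos_Mplus/head_pos.
have vn n : (0 < v n.+1%:R)%R by apply/v_gt0/dom_pos.
have large n : (n0 <= n.+1)%N -> (v n.+1%:R)%:E * X (head (nu_inv L nu n.+2%:R)) <= (C * K)%:E.
  move=> n0n; have n0n' : (n0%:R <= n.+1%:R :> R)%R by rewrite ler_nat.
  have := HC _ (le_trans n0tau n0n'); rewrite natr1 => H.
  apply: le_trans (lee_wpmul2l _ H) _; first by rewrite lee_fin ltW.
  rewrite muleCA EFinM; apply: lee_wpmul2l; first by rewrite lee_fin.
  by apply: HK; exact: lt_le_trans n0n'.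
have fin0 : X (head (nu_inv L nu n0.+1%:R)) \is a fin_num.
  rewrite ge0_fin_numE//; have := large n0.-1; rewrite /n0/= -/n0 => /(_ (leqnn _)).
  have vn0 : (0 < v n0%:R)%R := vn _.
  rewrite muleC -lee_pdivlMr// => /le_lt_trans; apply; exact: ltry.
pose x0 := fine (X (head (nu_inv L nu n0.+1%:R))).
exists (Num.max 0 (Num.max (C * K) (v 1 * x0)))%R; first by rewrite le_max lexx.
move=> n; have [n0n|nn0] := leqP n0 n.+1.
  by apply: le_trans (large n n0n) _; rewrite lee_fin !le_max lexx !orbT.
apply: (@le_trans _ _ (v 1 * x0)%:E); last by rewrite lee_fin !le_max lexx !orbT.
rewrite EFinM fineK//; apply: lee_pmul => //; first by rewrite lee_fin ltW.
  by rewrite lee_fin v_le//; [exact: dom_pos|exact: dom_pos|rewrite ler1n].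
apply: le_head; rewrite leNgt; apply/negP => lt.
have Dn k : D (nu_inv L nu k.+1%:R) by exact/nu_inv_dom/dom_pos.
move: lt; rewrite -nu_lt// !nu_invK; [|exact: dom_pos|exact: dom_pos].
by rewrite ltr_nat ltnNge ltnW.
Qed.

(** On [(0, 1)], where [v] may be unbounded, the whole interval is charged to [B]; each later piece
    costs at most [M] times its measure. The resulting bound is uniform in the truncation [n] and in
    the rearrangement. *)
Lemma condA_inf_varrho (E : set R) : condA_inf L u v nu X ->
  mble E -> E `<=` D -> mu E < +oo -> rho (fun t => (\1_E t)%:E) < +oo.
Proof.
move=> [/kern_norm_unit A1 /condA_limsup[K [T /condA_inf_bound[M M0 HM]]]] mE ED Eoo.
set B := N _ in A1.
have Mmu A : 0 <= M%:E * mu A by rewrite mule_ge0// lee_fin.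
apply: (@le_lt_trans _ _ (B + M%:E * mu E)); last first.
  by apply: lte_add_pinfty => //; apply: lte_mul_pinfty; rewrite ?lee_fin.
apply: varrho_le => h ph /(equi_ind mE ED ph)[F [mF FD FE hF]].
apply: le_trans (regular_mono kern_norm_regular ph (ind_pos mF) hF) _.
apply: (@le_trans _ _ (B + M%:E * mu F)); last first.
  by apply: leeD => //; apply: lee_wpmul2l; rewrite ?lee_fin.
pose F_ n := F `&` itv_oo 0 n.+1%:R%:E.
have mF_ n : mble (F_ n) by apply: measurableI => //; exact: itv_oo_mble.
have F_sub n k : (n <= k)%N -> F_ n `<=` F_ k.
  move=> nk t [Ft /andP[t0 tn]]; split=> //; apply/andP; split=> //.
  by apply: lt_le_trans tn _; rewrite lee_fin ler_nat ltnS.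
suff HF n : N (ind (F_ n)) <= B + M%:E * mu (F_ n).
  apply: (regular_fatou kern_norm_regular (f_ := fun n => ind (F_ n))) => [n||t Dt n k nk|t Dt|n].
  - exact: ind_pos.
  - exact: ind_pos.
  - by apply: le_ind; exact: F_sub.
  - apply: cvg_near_cst; near=> n; have [Ft|nF] := pselect (F t); last first.
      by rewrite !ind0// => -[].
    rewrite !indE//; split=> //; apply/andP; rewrite !lte_fin (dom_gt0 Dt); split=> //.
    apply: (@lt_trans _ _ n%:R); last by rewrite ltr_nat.
    by near: n; exact: nbhs_infty_gtr.
  - apply: le_trans (HF n) _; apply: leeD => //; apply: lee_wpmul2l; first by rewrite lee_fin.
    by apply: le_leb => //; exact: subIsetl.
elim: n => [|n IH].
  apply: (@le_trans _ _ B); last by rewrite leeDl.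
  apply: (regular_mono kern_norm_regular).
  - exact: ind_pos.
  - exact/ind_pos/itv_oo_mble.
  - by apply: aeW => t Dt; apply: le_ind; exact: subIsetr.
pose P := F_ n.+1 `\` F_ n.
have mP : mble P by exact: measurableD.
have FP : F_ n.+1 = F_ n `|` P by rewrite /P setDUK//; exact: F_sub.
have nP : N (ind P) <= M%:E * mu P.
  apply: le_trans (kern_norm_piece (al := n.+1%:R) (be := n.+2%:R) _ _ mP _) _ => //.
  - by rewrite ler_nat.
  - move=> t [[Ft /andP[t0 tn]] nF]; rewrite /= in_itv/= -lte_fin tn andbT leNgt.
    by apply/negP => tn1; apply: nF; split=> //; apply/andP.
  - by apply: lee_wpmul2r => //; exact: measure_ge0.
rewrite {2}FP lebU//; last by apply/seteqP; split=> // t [? []].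
rewrite ge0_muleDr// addeA.
apply: le_trans (leeD IH nP); apply: le_trans (kern_normD (ind_pos (mF_ n)) (ind_pos mP)).
apply: (regular_mono kern_norm_regular (ind_pos (mF_ n.+1))).
  by apply: pos_add; exact: ind_pos.
apply: aeW => t Dt; have [Ft|nF] := pselect (F_ n t).
  rewrite (indE Ft) (indE (F_sub n n.+1 _ _ Ft))// leeDl//.
  by rewrite lee_fin.
have [Pt|nP'] := pselect (P t); last by rewrite ind0 ?adde_ge0 ?lee_fin// FP => -[].
by rewrite (indE Pt) indE ?leeDr ?lee_fin// FP; right.
Unshelve. all: by end_near. Qed.

(** By [kern_norm_ge], the indicator of [(tau - 1, tau)] bounds [v tau] times the norm of [head] at
    [nu^-1 (tau - 1)], while its norm in [Z] is at most that of the indicator of [(0, 1)]. Then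
    [head_shift] replaces [tau - 1] by [tau]. *)
Lemma bounded_condA_inf Z : is_ri_norm L Z -> bounded_op L (H_op L u v nu) Z X ->
  condA_inf L u v nu X.
Proof.
move=> Z_ri HZ; have m01 : mble (itv_oo 0 1) by exact: itv_oo_mble.
have D01 : itv_oo 0 1 `<=` D by move=> t /andP[]; rewrite lte_fin => /dom_pos.
have Z01 : Z (ind (itv_oo 0 1)) < +oo.
  by apply: (rin_fin Z_ri) => //; rewrite leb_itv0// ltry.
split.
  apply/kern_norm_unit; apply: (bounded_kern_norm_ind Z_ri HZ) => //.
  by rewrite leb_itv0// ltry.
apply/condA_limsup; have [C [tau1 [C0 HC]]] := head_shift.
have [C' C'0 NZ] := bounded_kern_norm Z_ri HZ.
have Zfin : Z (ind (itv_oo 0 1)) \is a fin_num.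
  by rewrite ge0_fin_numE//; apply: (rin_ge0 Z_ri); exact/pos_Mplus/ind_pos.
(* The threshold makes [b = tau - 1] positive and larger than [tau1]. *)
exists (C * (C' * fine (Z (ind (itv_oo 0 1)))))%R, (Num.max tau1 0 + 1)%R.
move=> tau; rewrite -ltrBrDr => tau_gt; set b := (tau - 1)%R in tau_gt.
move: tau_gt; rewrite gt_max => /andP[b1 b0].
have tauE : tau = (b + 1)%R by rewrite /b subrK.
have Db := dom_pos b0; have tau0 : (0 < tau)%R by rewrite tauE addr_gt0.
have Dtau := dom_pos tau0.
have vt : (0 < v tau)%R by exact: v_gt0.
rewrite {2}tauE; apply: le_trans (lee_wpmul2l _ (HC _ (ltW b1))) _.
  by rewrite lee_fin ltW.
rewrite muleCA EFinM; apply: lee_wpmul2l; first by rewrite lee_fin.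
rewrite EFinM fineK//.
have mJ : mble (itv_oo b%:E (b + 1)%:E) by exact: itv_oo_mble.
have leJ : mu (itv_oo b%:E (b + 1)%:E) = 1%:E by rewrite leb_itv_oo ?lerDl// addrAC subrr add0r.
apply: (@le_trans _ _ (N (ind (itv_oo b%:E (b + 1)%:E)))).
  have Db1 : D (b + 1)%R by rewrite -tauE.
  have intJ : \int[mu]_(t in itv_oo b%:E (b + 1)%:E) ind (itv_oo b%:E (b + 1)%:E) t = 1%:E.
    by rewrite (@integral_indic _ _ _ (leb R) _ mJ _ mJ) setIid leJ.
  have := kern_norm_ge b0 Db1 (nu_inv_dom Db) (nu_invK Db) (ind_pos mJ) intJ.
  by rewrite mul1r -tauE.
apply: le_trans (NZ _ (ind_pos mJ)) _; apply: lee_wpmul2l; first by rewrite lee_fin ltW.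
apply: (rin_le_dist Z_ri (ind_pos mJ) (ind_pos m01)) => lam lam0.
have [l1|l1] := ltP lam 1%R.
  apply: (@le_trans _ _ (mu (itv_oo b%:E (b + 1)%:E))).
    apply: le_leb => //; first exact: Mfun_gt (ind_pos mJ).1.
    move=> t [Dt lt]; apply: contrapT => nJ; move: lt.
    by rewrite ind0// lte_fin ltNge ltW.
  apply: (@le_trans _ _ (mu (itv_oo 0 1))); first by rewrite leJ leb_itv0.
  apply: le_leb => //; first exact: Mfun_gt (ind_pos m01).1.
  by move=> t Jt; split; [exact: D01|rewrite indE// lte_fin].
rewrite /dist (_ : [set t | D t /\ lam%:E < ind (itv_oo b%:E (b + 1)%:E) t] = set0) ?measure0//.
apply/seteqP; split=> // t [_]; apply/negP; rewrite -leNgt.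
apply: (@le_trans _ _ (ind setT t)); first exact: le_ind.
by rewrite indE// lee_fin.
Qed.

End Infinite.
End Operator.

Theorem proposition3p5 (R : realType) (L : \bar R)
    (X : (R -> \bar R) -> \bar R) (u v nu : R -> R)
    (L_gt0 : 0 < L)
    (X_ri : is_ri_norm L X)
    (u_gt0 : forall t, dom L t -> (0 < u t)%R)
    (v_gt0 : forall t, dom L t -> (0 < v t)%R)
    (u_noninc : {in dom L &, {homo u : s t /~ (s <= t)%R}})
    (v_noninc : {in dom L &, {homo v : s t /~ (s <= t)%R}})
    (v_left : forall l : R, L = l%:E -> (0 < lim (v t @[t --> l^'-]))%R)
    (nu_bij : set_bij (dom L) (dom L) nu)
    (nu_incr : {in dom L &, {homo nu : s t / (s < t)%R}})
    (nu_D : L = +oo -> underD_infty nu) :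
  [/\ is_ri_norm L (varrho L u v nu X) <-> condA L u v nu X,
      condA L u v nu X ->
        optimal_domain L (H_op L u v nu) X (varrho L u v nu X) &
      ~ condA L u v nu X ->
        ~ exists Z : (R -> \bar R) -> \bar R,
            is_ri_norm L Z /\ bounded_op L (H_op L u v nu) Z X].
Proof.
have A_ri : condA L u v nu X -> is_ri_norm L (varrho L u v nu X).
  move=> [Afin Ainf]; apply: varrho_ri => // E mE ED Eoo.
  have [Llt|] := ltP L +oo; first by apply: condA_fin_varrho => //; exact: Afin.
  rewrite leye_eq => /eqP Loo; apply: condA_inf_varrho => //; first exact: nu_D.
  exact: Ainf.
(* Used twice: for an arbitrary [Z] it is the nonexistence claim, and for [Z = varrho] the necessity
   of (A). *)
have Z_A Z : is_ri_norm L Z -> bounded_op L (H_op L u v nu) Z X -> condA L u v nu X.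
  move=> Z_ri HZ; split=> [Llt|Loo].
    apply/condA_finE => //; apply: (bounded_kern_norm_ind _ _ _ _ _ _ X_ri Z_ri HZ) => //.
      exact: dom_mble.
    have Lfin : L \is a fin_num by rewrite ge0_fin_numE// ltW.
    have L0 : (0 <= fine L)%R by rewrite fine_ge0// ltW.
    by rewrite /dom -(fineK Lfin) leb_itv0// ltry.
  by apply: bounded_condA_inf Z_ri HZ => //; exact: nu_D.
(* The absolute value of a function is one of its own competitors in the supremum, so the operator
   is bounded from [varrho] to [X] with constant 1. *)
have bnd : bounded_op L (H_op L u v nu) (varrho L u v nu X) X by exact: varrho_bounded.
split.
- by split=> [rho_ri|//]; exact: Z_A rho_ri bnd.
- move=> A; split=> //; first exact: A_ri.
  by move=> Z Z_ri HZ; exact: varrho_optimal.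
- by move=> nA [Z [Z_ri HZ]]; apply: nA; exact: Z_A Z_ri HZ.
Qed.
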